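(* 1. (Sharpness of SABER) Suppose $L_1,\ldots,L_p$ are i.i.d. uniformly distributed over the $(n-1)$-sphere $S^{n-1}$. Then for an arbitrary random unit vector $U$ in $\mathbb{R}^n$ that is independent of the $L_j$'s, uniformly for all $n\ge 2$, as $p\to\infty$, the random variable $M_{p,n}=\max_{1\le j\le p}|\langle L_j,U\rangle|$ has the following convergence: $$M_{p,n}/\sqrt{1-p^{-2/(n-1)}}\to 1\quad\text{in probability},$$ i.e., for every $\delta>0$, as $p\to\infty$, $$\sup_{n\ge 2}\ \mathbb{P}\Big(\Big|\frac{M_{p,n}^2}{1-p^{-2/(n-1)}}-1\Big|>\delta\Big)\to 0.$$ 2. (Sharpness of SABRE) Similarly, suppose we observe $n$ i.i.d. samples of independent Gaussian variables $X_1,\ldots,X_p$ and an arbitrarily distributed random variable $Y$ that is independent of the $X_j$'s. Consider the maximal absolute sample correlation $M_{XY}=\max_{1\le j\le p}|\hat C(X_j,Y)|$. Uniformly for all $n\ge 3$, as $p\to\infty$, we have $$M_{XY}/\sqrt{1-p^{-2/(n-2)}}\to 1\quad\text{in probability.}$$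
   Context: $S^{n-1}$ is the unit sphere of $\mathbb{R}^n$, and $\langle\cdot,\cdot\rangle$ is the Euclidean inner product. For random variables $X,Y$ with $n$ i.i.d. observations $X_i$ and $Y_i$ ($i=1,\ldots,n$) of $X$ and $Y$ respectively, and sample means $\bar X,\bar Y$, the (Pearson) sample correlation is $$\hat C(X,Y)=\frac{\sum_{i=1}^n(X_i-\bar X)(Y_i-\bar Y)}{\sqrt{\sum_{i=1}^n(X_i-\bar X)^2}\sqrt{\sum_{i=1}^n(Y_i-\bar Y)^2}}.$$ SABER (Sharp Asymptotic Bound for indEpendent inner pRoducts) is the name of the bound $\sqrt{1-p^{-2/(n-1)}}$, and SABRE (Sharp Asymptotic Bound for spuRious corrElations) is the name of the bound $\sqrt{1-p^{-2/(n-2)}}$. ''Uniformly for all $n\ge n_0$'' means that the convergence in probability as $p\to\infty$ holds with the supremum over $n\ge n_0$ of the deviation probabilities tending to $0$, as displayed in part 1.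
   Formalization: In part 2 the deviation probability is taken conditionally on all sample correlations being defined (nonzero sample variances), since for Y with atoms (e.g. constant Y) they may be 0/0 and the literal claim fails; the Gaussian X_j are taken nondegenerate. *)

(* Defs.v *)
From HB Require Import structures.
From mathcomp Require Import all_boot all_order all_algebra.
From mathcomp Require Import all_classical all_reals all_analysis.
Set Implicit Arguments.
Unset Strict Implicit.
Unset Printing Implicit Defensive.
Import Order.TTheory GRing.Theory Num.Theory.
Import numFieldNormedType.Exports.

Local Open Scope classical_set_scope.
Local Open Scope ring_scope.

(* Vectors of R^n are n.-tuples, whose library sigma-algebra (the product of
   the Borel sigma-algebras) is the Borel sigma-algebra of R^n. *)
Section euclidean.
Context {R : realType} {n : nat}.
Implicit Types x y : n.-tuple R.

Definition inner x y : R := \sum_(i < n) tnth x i * tnth y i.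

Definition sphere : set (n.-tuple R) := [set x | Num.sqrt (inner x x) = 1].

Definition mx_act (Q : 'M[R]_n) x : n.-tuple R :=
  [tuple \sum_(k < n) Q i k * tnth x k | i < n].

(* The uniform distribution on the unit sphere, i.e. the normalized surface
   measure, is the probability measure on the sphere that is invariant under
   the orthogonal group. *)
Definition uniform_on_sphere (mu : probability (n.-tuple R) R) : Prop :=
  mu sphere = 1%E /\
  forall Q : 'M[R]_n, Q *m Q^T = 1%:M ->
  forall A : set (n.-tuple R), measurable A -> mu (mx_act Q @^-1` A) = mu A.

End euclidean.

Section correlation.
Context {R : realType} {n : nat}.
Implicit Types x y : 'I_n -> R.

Definition sample_mean x : R := (\sum_(i < n) x i) / n%:R.

Definition sum_sq_dev x : R := \sum_(i < n) (x i - sample_mean x) ^+ 2.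

Definition sample_corr x y : R :=
  (\sum_(i < n) (x i - sample_mean x) * (y i - sample_mean y)) /
  (Num.sqrt (sum_sq_dev x) * Num.sqrt (sum_sq_dev y)).

(* Where this fails, sample_corr divides by zero. *)
Definition corr_defined x y : Prop := sum_sq_dev x != 0 /\ sum_sq_dev y != 0.

End correlation.

Section independence.
Context {d d1 d2 : measure_display} {T : measurableType d}.
Context {T1 : measurableType d1} {T2 : measurableType d2} {R : realType}.
Variable P : probability T R.

Definition indep (X : T -> T1) (Y : T -> T2) : Prop :=
  forall (A : set T1) (B : set T2), measurable A -> measurable B ->
  P (X @^-1` A `&` Y @^-1` B) = (P (X @^-1` A) * P (Y @^-1` B))%E.

Definition mutual_indep (I : finType) (X : I -> T -> T1) : Prop :=
  forall (J : {set I}) (A : I -> set T1),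
  (forall i, i \in J -> measurable (A i)) ->
  P (\bigcap_(i in [set` J]) X i @^-1` A i) =
  (\prod_(i in J) P (X i @^-1` A i))%E.

Definition iid (I : finType) (X : I -> T -> T1) : Prop :=
  mutual_indep X /\
  forall i j (A : set T1), measurable A -> P (X i @^-1` A) = P (X j @^-1` A).

(* P (A | B), with value 0 when P B = 0: indeed 0 / 0 = 0 * +oo = 0. *)
Definition cond_prob (A B : set T) : \bar R := (P (A `&` B) / P B)%E.

End independence.

(* q n p tends to 0 as p --> oo, uniformly in n >= n0. *)
Definition unif_vanish {R : realType} (n0 : nat) (q : nat -> nat -> \bar R) :
    Prop :=
  ereal_sup [set q n p | n in [set n | (n0 <= n)%N]] @[p --> \oo] --> 0%E.

Definition saber {R : realType} (n p : nat) : R :=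
  Num.sqrt (1 - p%:R `^ (- (2 / (n%:R - 1)))).

Definition sabre {R : realType} (n p : nat) : R :=
  Num.sqrt (1 - p%:R `^ (- (2 / (n%:R - 2)))).

(* Maxima of nonnegative quantities, so the unit 0 of the iterated maximum is
   harmless. *)
Definition max_inner {R : realType} {n p : nat} (L : 'I_p -> n.-tuple R)
    (U : n.-tuple R) : R :=
  \big[Num.max/0]_(j < p) `|inner (L j) U|.

(* x i j is the i-th observation of the j-th variable. *)
Definition max_corr {R : realType} {n p : nat} (x : 'I_n -> 'I_p -> R)
    (y : 'I_n -> R) : R :=
  \big[Num.max/0]_(j < p) `|sample_corr (x ^~ j) y|.

(* Main.v *)
Require Import Defs.
From HB Require Import structures.
From mathcomp Require Import all_boot all_order all_algebra.
From mathcomp Require Import all_classical all_reals all_analysis.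
From mathcomp Require Import measurable_realfun.
From mathcomp Require Import ring lra.
Set Implicit Arguments.
Unset Strict Implicit.
Unset Printing Implicit Defensive.
Import Order.TTheory GRing.Theory Num.Theory.
Import numFieldNormedType.Exports.

Local Open Scope classical_set_scope.
Local Open Scope ring_scope.

(* Conditionally on U (resp. on Y), the p statistics are independent, and each
   of their squares is distributed as z_0^2 / |z|^2 for a standard Gaussian
   vector z of R^(k+1), where k = n - 1 (resp. k = n - 2).  For an invariant law
   mu on the sphere this is seen by integrating the indicator of
   {(x, z) | t |z| < |<x, z>|} against mu and the Gaussian measure in both
   orders; for correlations, centring is the orthogonal projection along the
   all-ones vector, which a Gaussian-preserving isometry moves to a coordinate
   axis.

   Writing z = (z_0, z') and s = t^2 / (1 - t^2), the event t |z| < |z_0| is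
   s |z'|^2 < z_0^2.  The tail P(x < z_0^2) lies between multiples of
   exp(- (1 + e) x / 2) and exp(- (1 - e) x / 2), and the Laplace transform of
   |z'|^2 turns this into bounds of the form C (1 + (1 -+ e) s)^(- k / 2), with C
   depending on e only.  At t^2 = (1 +- d)(1 - p^(-2/k)) and for e small with
   respect to d, the probability H of the event satisfies p H <= C p^(- d / 2),
   resp. p H >= c p^(d / 2), uniformly in k.  The union bound and
   (1 - H)^p <= exp(- p H) conclude. *)

(** * Product measures on tuples *)

(** Uniformity in the dimension is the obstacle: tail asymptotics for the Beta law of a squared
    inner product come with constants that depend on k. In the Gaussian representation the k
    coordinates of z' contribute an exact k-th power, and the radius contains the root p^(2/k), so k
    cancels when the power is taken. The remaining constants come from one-dimensional Gaussian
    tails and depend on e only. Losing a factor 1 -+ e in the tail exponent is affordable because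
    the squared radius is off by the factor 1 +- d: half of d pays for e, the other half is the
    exponent d / 2 that is left.

    The uniform law is known only through its invariance, without density or parametrization, so
    unit vectors are moved by explicit reflections.

    For correlations the conditioning event may have arbitrarily small probability, so a bound on
    the joint probability must be proportional to it. Hence the estimates over product measures
    carry a set D of admissible values of the conditioning variable, and the factor [nu D]. *)

Lemma measurable_ltr_set {R : realType} d (T : measurableType d) (f g : T -> R) :
  measurable_fun setT f -> measurable_fun setT g -> measurable [set x | f x < g x].
Proof.
move=> mf mg.
have := measurable_fun_ltr mf mg measurableT (I : measurable [set true]).
by rewrite setTI.
Qed.

Lemma measurable_eqr_set {R : realType} d (T : measurableType d) (f : T -> R) (a : R) :
  measurable_fun setT f -> measurable [set x | f x = a].
Proof. by move=> /(_ measurableT _ (measurable_set1 a)); rewrite setTI. Qed.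

Lemma measurable_deviation {R : realType} d (T : measurableType d) (M : T -> R) (e v : R) :
  measurable_fun setT M -> measurable [set w | e < `|M w / v - 1|].
Proof.
move=> mM; apply: measurable_ltr_set => //; apply: measurableT_comp => //.
by apply: measurable_funB => //; exact: measurable_funM.
Qed.

Lemma measurable_mktuple {d d' : measure_display} {T : measurableType d}
    {T' : measurableType d'} n (F : 'I_n -> T -> T') :
  (forall i, measurable_fun setT (F i)) ->
  measurable_fun setT (fun w => [tuple F i w | i < n]).
Proof.
move=> mF; apply/measurable_fun_tnthP => i.
by rewrite (_ : _ \o _ = F i)//; apply/funext => w /=; rewrite tnth_mktuple.
Qed.

Lemma measurable_forall_ord d (T : measurableType d) p (E : 'I_p -> set T) :
  (forall j, measurable (E j)) -> measurable [set w | forall j, E j w].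
Proof.
move=> mE; rewrite (_ : [set w | _] = \big[setI/setT]_(j < p) E j).
  exact: bigsetI_measurable.
rewrite -bigcap_seq; apply/seteqP; split => w /= h j; first by move=> _; exact: h.
by apply: h; rewrite /= mem_index_enum.
Qed.

Lemma measurable_bigmax0 {R : realType} d (T : measurableType d) p (F : 'I_p -> T -> R) :
  (forall j, measurable_fun setT (F j)) ->
  measurable_fun setT (fun w => \big[Num.max/0]_(j < p) F j w).
Proof.
move=> mF; elim: (index_enum _) => [|j r IH].
  by under eq_fun do rewrite big_nil; exact: measurable_cst.
by under eq_fun do rewrite big_cons; exact: measurable_maxr.
Qed.

Section tuple_prod.
Context {R : realType} {d : measure_display} {T : measurableType d}.

Definition tuple_cons n (vx : n.-tuple T * T) : n.+1.-tuple T :=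
  [the n.+1.-tuple T of vx.2 :: vx.1].

Lemma measurable_tuple_cons n : measurable_fun setT (@tuple_cons n).
Proof. exact: measurable_cons. Qed.

HB.instance Definition _ n :=
  isMeasurableFun.Build _ _ _ _ (@tuple_cons n) (@measurable_tuple_cons n).

(** The factors may differ, because the laws of the [L j] enter as separate measures. The recursion
    splits off the head, so an integral over [n.+1] coordinates is one over the tail with an inner
    one over the head. *)
Fixpoint tuple_prod n : ('I_n -> probability T R) -> probability (n.-tuple T) R :=
  match n with
  | 0 => fun _ => dirac [tuple]
  | m.+1 => fun mu =>
     distribution (tuple_prod (mu \o lift ord0) \x mu ord0)%E (@tuple_cons m)
  end.

Definition box n (A : 'I_n -> set T) : set (n.-tuple T) :=
  [set x | forall i, A i (tnth x i)].

Lemma measurable_box n (A : 'I_n -> set T) :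
  (forall i, measurable (A i)) -> measurable (box A).
Proof.
move=> mA.
have -> : box A = \big[setI/setT]_(i < n) ((fun x : n.-tuple T => tnth x i) @^-1` A i).
  rewrite -bigcap_seq; apply/seteqP; split => x /= h i.
    by move=> _; exact: h.
  by apply: h; rewrite /= mem_index_enum.
apply: bigsetI_measurable => i _; rewrite -[_ @^-1` _]setTI.
exact: measurable_tnth.
Qed.

Lemma tuple_cons_tnth0 n (vx : n.-tuple T * T) : tnth (tuple_cons vx) ord0 = vx.2.
Proof. by rewrite tnth0. Qed.

Lemma tuple_cons_tnthS n (vx : n.-tuple T * T) i :
  tnth (tuple_cons vx) (lift ord0 i) = tnth vx.1 i.
Proof. by rewrite tnthS. Qed.

Lemma tuple_cons_box n (A : 'I_n.+1 -> set T) :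
  @tuple_cons n @^-1` box A = box (A \o lift ord0) `*` A ord0.
Proof.
apply/seteqP; split => -[v x] /=.
  move=> h; split => [i|] /=.
    by have := h (lift ord0 i); rewrite tuple_cons_tnthS.
  by have := h ord0; rewrite tuple_cons_tnth0.
move=> [h1 h2] i; case: (unliftP ord0 i) => [j ->|->].
  by rewrite tuple_cons_tnthS; exact: h1.
by rewrite tuple_cons_tnth0.
Qed.

Lemma tuple_prod_box n (mu : 'I_n -> probability T R) (A : 'I_n -> set T) :
  (forall i, measurable (A i)) ->
  tuple_prod mu (box A) = (\prod_(i < n) mu i (A i))%E.
Proof.
elim: n mu A => [|n IH] mu A mA /=.
  rewrite big_ord0 diracE (_ : _ \in _ = true)//.
  by apply/mem_set => -[].
rewrite /distribution /pushforward tuple_cons_box product_measure1E//.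
  rewrite big_ord_recl muleC; congr (_ * _)%E.
  exact: (IH (mu \o lift ord0) (A \o lift ord0) (fun i => mA _)).
by apply: measurable_box => i; exact: mA.
Qed.

Lemma tuple_prodS n (mu : 'I_n.+1 -> probability T R) (f : n.+1.-tuple T -> \bar R) :
  measurable_fun [set: n.+1.-tuple T] f -> (forall x, 0 <= f x)%E ->
  (\int[tuple_prod mu]_x f x =
   \int[tuple_prod (mu \o lift ord0)]_v \int[mu ord0]_x f (tuple_cons (v, x)))%E.
Proof.
move=> mf f0 /=.
rewrite ge0_integral_distribution//.
rewrite (fubini_tonelli1 (f \o _))//.
  exact: (measurableT_comp mf (@measurable_tuple_cons n)).
by move=> x; exact: f0.
Qed.

(** A condition on a single coordinate is a box whose other sides are the full set, hence
    [G setT]. *)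
Lemma measurable_tupleE n (G : set (set T)) :
  @measurable _ T = <<s G >> -> G setT ->
  @measurable _ (n.-tuple T) = <<s [set box A | A in [set A | forall i, G (A i)]] >>.
Proof.
move=> GE GT; set B := [set box A | A in _].
have mG A : G A -> measurable A by rewrite GE; exact: sub_sigma_algebra.
apply/seteqP; split; last first.
  apply: smallest_sub; first exact: sigma_algebra_measurable.
  by move=> _ [A GA <-]; apply: measurable_box => i; exact: mG.
apply: smallest_sub; first exact: smallest_sigma_algebra.
move=> X; rewrite -bigcup_seq /= => -[i _ [Y mY <-]].
have : @measurable_fun _ _ (g_sigma_algebraType B) T setT (fun x => tnth x i).
  apply: (@measurability _ _ (g_sigma_algebraType B) T setT (fun x => tnth x i) G GE).
  move=> _ [A GA <-]; apply: sub_sigma_algebra.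
  exists (fun j => if j == i then A else setT).
    by move=> j /=; case: ifP.
  apply/seteqP; split => x /=.
    by move=> /(_ i); rewrite eqxx.
  by move=> [_ ?] j; case: eqP => // ->.
by move=> /(_ measurableT _ mY).
Qed.

Lemma setI_closed_box n (G : set (set T)) : setI_closed G ->
  setI_closed [set box A | A in [set A : 'I_n -> set T | forall i, G (A i)]].
Proof.
move=> GI _ _ [A GA <-] [B GB <-]; exists (fun i => A i `&` B i).
  by move=> i; exact: GI.
apply/seteqP; split => x /= h; first by split => i; have [] := h i.
by move=> i; split; case: h => /(_ i) ? /(_ i).
Qed.

Lemma tuple_measure_unique n (G : set (set T))
    (m1 m2 : {measure set (n.-tuple T) -> \bar R}) :
  @measurable _ T = <<s G >> -> setI_closed G -> G setT -> (m1 setT < +oo)%E ->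
  (forall A, (forall i, G (A i)) -> m1 (box A) = m2 (box A)) ->
  forall E, measurable E -> m1 E = m2 E.
Proof.
move=> GE GI GT m1oo m12 E mE.
apply: (measure_unique [set box A | A in [set A | forall i, G (A i)]] (fun=> setT))
  => //.
- exact: measurable_tupleE.
- exact: setI_closed_box.
- by move=> _; exists (fun=> setT) => //; apply/seteqP; split => x.
- by apply/seteqP; split => x // _; exists 0%N.
- by move=> _ [A GA <-]; exact: m12.
Qed.

End tuple_prod.

Section product_bound.
Context {R : realType} {d d' : measure_display}.
Context {T : measurableType d} {T' : measurableType d'}.
Local Open Scope ereal_scope.

(** Sections outside D are empty, so integrating the section bound keeps the factor [nu D]; for
    correlations it becomes the probability of the conditioning event. *)
Lemma product_measure_le (nu : probability T' R) (tau : probability T R)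
    (E : set (T' * T)) (D : set T') (c : R) :
  measurable E -> measurable D -> (0 <= c)%R ->
  (forall w, D w -> tau (xsection E w) <= c%:E) ->
  (forall w, ~ D w -> xsection E w = set0) ->
  (nu \x tau) E <= c%:E * nu D.
Proof.
move=> mE mD c0 hD hnD; rewrite /product_measure1.
have -> : c%:E * nu D = \int[nu]_w ((cst c%:E) \_ D) w.
  by rewrite -integral_mkcond integral_cst.
apply: ge0_le_integral => //=.
- exact: measurable_fun_xsection.
- apply/(measurable_restrictT _ _).1 => //.
- move=> w _; rewrite patchE; case: ifPn => [/set_mem|/negP Dw].
    exact: hD.
  by rewrite hnD ?measure0// => ?; apply: Dw; exact: mem_set.
Qed.

End product_bound.

Section tuple_prod_bounds.
Context {R : realType} {d d' : measure_display}.
Context {T : measurableType d} {T' : measurableType d'}.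
Local Open Scope ereal_scope.
Variables (p : nat) (mu : 'I_p -> probability T R).

Lemma tuple_prod_marginal (A : set T) j : measurable A ->
  tuple_prod mu [set v | A (tnth v j)] = mu j A.
Proof.
move=> mA; pose B i := if i == j then A else setT.
have -> : [set v : p.-tuple T | A (tnth v j)] = box B.
  apply/seteqP; split => v /=.
    by move=> Av i; rewrite /B; case: eqP => // ->.
  by move=> /(_ j); rewrite /B eqxx.
rewrite tuple_prod_box; last by move=> i; rewrite /B; case: ifP.
rewrite (bigD1 j)//= {1}/B eqxx big1 ?mule1// => i ij.
by rewrite /B (negbTE ij) probability_setT.
Qed.

Lemma tuple_prod_union (A : 'I_p -> set T) : (forall j, measurable (A j)) ->
  tuple_prod mu [set v | exists j, A j (tnth v j)] <= \sum_(j < p) mu j (A j).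
Proof.
move=> mA.
have mAj j : measurable [set v : p.-tuple T | A j (tnth v j)].
  by rewrite -[X in measurable X]setTI; exact: measurable_tnth.
have -> : [set v : p.-tuple T | exists j, A j (tnth v j)] =
   \big[setU/set0]_(j < p) [set v | A j (tnth v j)].
  rewrite -bigcup_seq; apply/seteqP; split => v /=.
    by move=> [j Aj]; exists j => //=; rewrite mem_index_enum.
  by move=> [j _ Aj]; exists j.
suff [] : measurable (\big[setU/set0]_(j < p) [set v : p.-tuple T | A j (tnth v j)]) /\
  tuple_prod mu (\big[setU/set0]_(j < p) [set v : p.-tuple T | A j (tnth v j)]) <=
  \sum_(j < p) mu j (A j) by [].
elim/big_rec2: _ => [|j y X _ [mX Xy]]; first by rewrite measure0.
split; first exact: measurableU.
apply: le_trans (measureU2 _ _ _) _ => //.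
apply: leeD => //; rewrite -(tuple_prod_marginal j (mA j)).
exact: lexx.
Qed.

Lemma tuple_prod_avoid (A : 'I_p -> set T) (g : R) : (forall j, measurable (A j)) ->
  (0 <= g)%R -> (forall j, g%:E <= mu j (A j)) ->
  tuple_prod mu [set v | forall j, ~ A j (tnth v j)] <= ((1 - g) ^+ p)%:E.
Proof.
move=> mA g0 gA.
rewrite (_ : [set v | _] = box (fun j => ~` A j)); last by [].
rewrite tuple_prod_box; last by move=> j; exact: measurableC.
have -> : ((1 - g) ^+ p)%:E = \prod_(j < p) (1 - g)%:E.
  by rewrite prodEFin prodr_const card_ord.
have : forall j, 0 <= mu j (~` A j) <= (1 - g)%:E.
  move=> j; rewrite measure_ge0/= probability_setC//.
  by rewrite EFinB leeB.
move=> hA; have [//] : 0 <= \prod_(i < p) mu i (~` A i) /\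
    \prod_(i < p) mu i (~` A i) <= \prod_(j < p) (1 - g)%:E.
elim/big_rec2 : _ => [|j y x _ [x0 xy]]; first by rewrite lee01.
have /andP[a0 ag] := hA j.
by split; [exact: mule_ge0|exact: lee_pmul].
Qed.

Variable nu : probability T' R.
Variables (S : set (T' * T)) (mS : measurable S) (D : set T') (mD : measurable D).

Let mSj j : measurable [set wv : T' * p.-tuple T | S (wv.1, tnth wv.2 j)].
Proof.
have mf : measurable_fun setT (fun wv : T' * p.-tuple T => (wv.1, tnth wv.2 j)).
  apply: measurable_fun_pair => //.
  by apply: (measurableT_comp (measurable_tnth j)).
by rewrite -[X in measurable X]setTI; exact: mf.
Qed.

Lemma measurable_exists_section :
  measurable [set wv : T' * p.-tuple T | D wv.1 /\ exists j, S (wv.1, tnth wv.2 j)].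
Proof.
have -> : [set wv : T' * p.-tuple T | D wv.1 /\ exists j, S (wv.1, tnth wv.2 j)] =
   fst @^-1` D `&`
   \big[setU/set0]_(j < p) [set wv : T' * p.-tuple T | S (wv.1, tnth wv.2 j)].
  rewrite -bigcup_seq; apply/seteqP; split => v /=.
    by move=> [Dv [j Aj]]; split => //; exists j => //=; rewrite mem_index_enum.
  by move=> [Dv [j _ Aj]]; split => //; exists j.
apply: measurableI; first by rewrite -[X in measurable X]setTI; exact: measurable_fst.
exact: bigsetU_measurable.
Qed.

Lemma measurable_forall_section :
  measurable [set wv : T' * p.-tuple T | D wv.1 /\ forall j, ~ S (wv.1, tnth wv.2 j)].
Proof.
have -> : [set wv : T' * p.-tuple T | D wv.1 /\ forall j, ~ S (wv.1, tnth wv.2 j)] =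
   (fst @^-1` D) `\`
     [set wv : T' * p.-tuple T | D wv.1 /\ exists j, S (wv.1, tnth wv.2 j)].
  apply/seteqP; split => v /= [Dv h]; split => //.
    by move=> [_ [j]]; exact: h.
  by move=> j Sj; apply: h; split => //; exists j.
apply: measurableD; last exact: measurable_exists_section.
by rewrite -[X in measurable X]setTI; exact: measurable_fst.
Qed.

Lemma product_exists_section_le (q : R) : (0 <= q)%R ->
  (forall w j, D w -> mu j (xsection S w) <= q%:E) ->
  (nu \x tuple_prod mu)
    [set wv : T' * p.-tuple T | D wv.1 /\ exists j, S (wv.1, tnth wv.2 j)]
  <= (p%:R * q)%:E * nu D.
Proof.
move=> q0 hq; apply: product_measure_le => //.
- exact: measurable_exists_section.
- by rewrite mulr_ge0.
- move=> w Dw.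
  have -> : xsection [set wv : T' * p.-tuple T | D wv.1 /\ exists j, S (wv.1, tnth wv.2 j)] w
    = [set v | exists j, xsection S w (tnth v j)].
    apply/seteqP; split => v /=; rewrite /xsection /= inE /=.
      by move=> [_ [j Sj]]; exists j; exact: mem_set.
    by move=> [j /set_mem Sj]; split => //; exists j.
  have mSw (j : 'I_p) : measurable (xsection S w) by exact: measurable_xsection.
  apply: le_trans (tuple_prod_union mSw) _.
  apply: le_trans (lee_sum _ (fun j _ => hq w j Dw)) _.
  by rewrite sumEFin sumr_const card_ord mulr_natl.
- move=> w Dw; rewrite -subset0 => v; rewrite /xsection /= inE /=.
  by move=> [].
Qed.

Lemma product_forall_section_le (g : R) : (0 <= g <= 1)%R ->
  (forall w j, D w -> g%:E <= mu j (xsection S w)) ->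
  (nu \x tuple_prod mu)
    [set wv : T' * p.-tuple T | D wv.1 /\ forall j, ~ S (wv.1, tnth wv.2 j)]
  <= ((1 - g) ^+ p)%:E * nu D.
Proof.
move=> /andP[g0 g1] hg; apply: product_measure_le => //.
- exact: measurable_forall_section.
- by rewrite exprn_ge0// subr_ge0.
- move=> w Dw.
  have -> : xsection [set wv : T' * p.-tuple T | D wv.1 /\ forall j, ~ S (wv.1, tnth wv.2 j)] w
    = [set v | forall j, ~ xsection S w (tnth v j)].
    apply/seteqP; split => v /=; rewrite /xsection /= inE /=.
      by move=> [_ h] j /set_mem; exact: h.
    by move=> h; split => // j Sj; apply: (h j); exact: mem_set.
  have mSw (j : 'I_p) : measurable (xsection S w) by exact: measurable_xsection.
  by apply: (tuple_prod_avoid mSw) => // j; exact: hg.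
- move=> w Dw; rewrite -subset0 => v; rewrite /xsection /= inE /=.
  by move=> [].
Qed.

End tuple_prod_bounds.

(** * The one-dimensional Gaussian measure *)

Section lebesgue_affine.
Context {R : realType}.
Notation leb := (@lebesgue_measure R).

Lemma measurable_affine (a b : R) : measurable_fun setT (fun x : R => a * x + b).
Proof. by apply: measurable_funD => //; exact: measurable_funM. Qed.

(** The right-hand side agrees with Lebesgue measure on half-open intervals, which determine it. A
    negative a reverses the interval and its open end, hence the case split. *)
Lemma lebesgue_measure_affine (a b : R) (A : set R) : a != 0 -> measurable A ->
  (leb A = `|a|%:E * leb ((fun x => (a * x + b)%R) @^-1` A))%E.
Proof.
move=> a0 mA.
pose g := fun x : measurableTypeR R => (a * x + b : measurableTypeR R).
have mg : measurable_fun setT g := measurable_affine a b.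
have na0 : 0 <= `|a| by [].
pose m := mscale (NngNum na0) (pushforward leb g).
apply: (@lebesgue_measure_unique R (m mg)) => // _ [[x y] _ <-] /=.
rewrite /m /mscale /pushforward /= lebesgue_measure_itv /= lte_fin.
have [agt0|alt0|/eqP] := ltgtP 0 a; last by rewrite eq_sym (negbTE a0).
- have gE : g @^-1` `]x, y] = `](x - b) / a, (y - b) / a]%classic.
    apply/seteqP; split => z; rewrite /= !in_itv /= /g => /andP[h1 h2].
      by rewrite ltr_pdivrMr// ler_pdivlMr// ltrBlDr lerBrDr mulrC h1.
    by move: h1 h2; rewrite ltr_pdivrMr// ler_pdivlMr// ltrBlDr lerBrDr mulrC => -> ->.
  rewrite /pushforward gE lebesgue_measure_itv /= lte_fin ltr_pM2r ?invr_gt0// ltrD2r.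
  case: ifPn => _; last by rewrite mule0.
  rewrite -!EFinB -EFinM; congr (_%:E); rewrite gtr0_norm//; field; exact: a0.
- have gE : g @^-1` `]x, y] = `[(y - b) / a, (x - b) / a[%classic.
    apply/seteqP; split => z; rewrite /= !in_itv /= /g => /andP[h1 h2].
      by rewrite ltr_ndivlMr// ler_ndivrMr// ltrBlDr lerBrDr mulrC h1 andbT.
    by move: h1 h2; rewrite ltr_ndivlMr// ler_ndivrMr// ltrBlDr lerBrDr mulrC => -> ->.
  rewrite /pushforward gE lebesgue_measure_itv /= lte_fin ltr_nM2r ?invr_lt0// ltrD2r.
  case: ifPn => _; last by rewrite mule0.
  rewrite -!EFinB -EFinM; congr (_%:E); rewrite ltr0_norm//; field; exact: a0.
Qed.

Lemma integral_affine (a b : R) (f : measurableTypeR R -> \bar R) : a != 0 ->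
  measurable_fun setT f -> (forall x, 0 <= f x)%E ->
  (\int[leb]_x f x = `|a|%:E * \int[leb]_x f (a * x + b)%R)%E.
Proof.
move=> a0 mf f0.
pose g := fun x : measurableTypeR R => (a * x + b : measurableTypeR R).
have mg : measurable_fun setT g := measurable_affine a b.
have na0 : 0 <= `|a| by [].
pose m := mscale (NngNum na0) (pushforward leb g).
rewrite (eq_measure_integral (m mg)); last first.
  by move=> A mA _; exact: lebesgue_measure_affine.
by rewrite ge0_integral_mscale//= ge0_integral_pushforward.
Qed.

(** The Radon-Nikodym derivative and the explicit density have equal integrals over every measurable
    set, so they agree almost everywhere. *)
Lemma integral_normal (m s : R) (f : measurableTypeR R -> \bar R) :
  measurable_fun setT f -> (forall x, 0 <= f x)%E ->
  (\int[normal_prob m s]_x f x = \int[leb]_x (f x * (normal_pdf m s x)%:E))%E.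
Proof.
move=> mf f0.
have dom := normal_prob_dominates m s.
rewrite -(Radon_Nikodym_SigmaFinite.change_of_variables dom)//.
have mpdf : measurable_fun setT (fun x => (normal_pdf m s x)%:E).
  by apply/measurable_EFinP; exact: measurable_normal_pdf.
have iRN := Radon_Nikodym_SigmaFinite.f_integrable dom.
have mRN := measurable_int _ iRN.
apply: ae_eq_integral => //.
- exact: emeasurable_funM.
- exact: emeasurable_funM.
- apply: ae_eqe_mul2l.
  apply: integral_ae_eq => // A _ mA.
  by rewrite -Radon_Nikodym_SigmaFinite.f_integral.
Qed.

End lebesgue_affine.

Section lebesgue_reflection.
Context {R : realType}.
Notation leb := (@lebesgue_measure R).
Notation RR := (measurableTypeR R * measurableTypeR R)%type.
Local Open Scope ereal_scope.

Let measurable_lin (a b c d : R) :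
  measurable_fun setT (fun z : RR => ((a * z.1 + b * z.2)%R, (c * z.1 + d * z.2)%R) : RR).
Proof.
by apply: measurable_fun_pair; apply: measurable_funD; apply: measurable_funM.
Qed.

(** Two affine substitutions on the line, separated by Tonelli: for fixed w replace z by u = a z + b
    w, then for fixed u replace w by v = (b u - w) / a, which equals b z - a w. The two scale
    factors cancel. *)
Lemma lebesgue_reflection (a b : R) (h : RR -> \bar R) :
  (a ^+ 2 + b ^+ 2 = 1)%R -> measurable_fun setT h -> (forall z, 0 <= h z) ->
  \int[leb]_z \int[leb]_w h ((a * z + b * w)%R, (b * z - a * w)%R) =
  \int[leb]_z \int[leb]_w h (z, w).
Proof.
move=> ab1 mh h0.
have mlin a1 b1 c1 d1 :
    measurable_fun setT (fun z : RR => h ((a1 * z.1 + b1 * z.2)%R, (c1 * z.1 + d1 * z.2)%R)).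
  exact: (measurableT_comp mh (measurable_lin a1 b1 c1 d1)).
have mhu u : measurable_fun setT (fun v => h (u, v)).
  by apply: (measurableT_comp mh); exact: measurable_fun_pair.
have m1 : measurable_fun setT (fun z : RR => h ((a * z.1 + b * z.2)%R, (b * z.1 - a * z.2)%R)).
  by under eq_fun do rewrite -mulNr; exact: mlin.
apply: etrans (fubini_tonelli (m1 := leb) (m2 := leb) _ m1 (fun=> h0 _)) _ => /=.
(* When a vanishes, the substitution is impossible; then b is 1 or -1 and the map swaps the
   coordinates up to sign. *)
have [a0|a0] := eqVneq a 0%R.
  have b1 : (`|b| = 1)%R.
    by apply/eqP; rewrite -sqrp_eq1// -normrX -ab1 a0 expr0n add0r; rewrite ger0_norm// sqr_ge0.
  have b0 : (b != 0)%R by rewrite -normr_eq0 b1 oner_eq0.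
  have mG : measurable_fun setT (fun u => \int[leb]_v h (u, v)).
    exact: (measurable_fun_fubini_tonelli_F h).
  rewrite [RHS](integral_affine 0 b0 mG); last by move=> u; exact: integral_ge0.
  rewrite b1 mul1e; apply: eq_integral => w _ /=.
  rewrite [RHS](integral_affine 0 b0 (mhu _))// b1 mul1e.
  by apply: eq_integral => z _ /=; rewrite a0 !mul0r add0r addr0 subr0 addr0.
transitivity (\int[leb]_w \int[leb]_u (`|a|^-1%:E * h (u, ((b * u - w) / a)%R))).
  apply: eq_integral => w _ /=.
  have mk : measurable_fun setT (fun u => h (u, ((b * u - w) / a)%R)).
    apply: (measurableT_comp mh); apply: measurable_fun_pair => //.
    by apply: measurable_funM => //; apply: measurable_funB => //; exact: measurable_funM.
  rewrite ge0_integralZl_EFin ?invr_ge0//.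
  rewrite (integral_affine (b * w) a0 mk)// muleA -EFinM mulVf ?normr_eq0// mul1e.
  apply: eq_integral => z _ /=; congr (h (_, _)).
  have -> : (b * (a * z + b * w) - w = a * (b * z - a * w))%R.
    transitivity (a * b * z + b ^+ 2 * w - w * 1)%R; first by ring.
    by rewrite -ab1; ring.
  by rewrite mulrAC divff// mul1r.
pose K z := `|a|^-1%:E * h (z.1, ((b * z.1 - z.2) / a)%R).
have mK : measurable_fun [set: RR] K.
  apply: measurable_funeM.
  apply: (measurableT_comp mh); apply: measurable_fun_pair => //=.
  apply: measurable_funM => //; apply: measurable_funB => //.
  exact: measurable_funM.
have K0 z : 0 <= K z by rewrite mule_ge0// lee_fin invr_ge0.
apply: etrans (esym (fubini_tonelli (m1 := leb) (m2 := leb) _ mK K0)) _.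
apply: eq_integral => u _ /=.
have ia0 : (- a^-1 != 0)%R by rewrite oppr_eq0 invr_eq0.
rewrite (integral_affine (b * u / a) ia0 (mhu u))//.
rewrite normrN normfV -ge0_integralZl_EFin ?invr_ge0//; last first.
  exact: (measurableT_comp (mhu u) (measurable_affine _ _)).
apply: eq_integral => w _ /=; congr (_ * h (_, _)).
by rewrite /=; field.
Qed.

End lebesgue_reflection.

Section stdnormal.
Context {R : realType}.
Notation leb := (@lebesgue_measure R).
Local Open Scope ereal_scope.

(* The library's normal law lives on the Borel space generated by the
   intervals ]a, b], whose display is not the one of the canonical Borel space
   on R; stdnormal transports it to the latter along this identity map. *)
Definition borel_id (x : measurableTypeR R) : R := x.

Lemma measurable_borel_id : measurable_fun setT borel_id.
Proof. by move=> _ A mA; rewrite setTI. Qed.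

HB.instance Definition _ :=
  isMeasurableFun.Build _ _ _ _ borel_id measurable_borel_id.

Definition stdnormal : probability R R := distribution (normal_prob 0 1) borel_id.

Lemma stdnormalE (A : set R) : stdnormal A = normal_prob 0 1 A.
Proof. by []. Qed.

Lemma integral_stdnormal (f : R -> \bar R) :
  measurable_fun setT f -> (forall x, 0 <= f x) ->
  \int[stdnormal]_x f x = \int[leb]_x (f x * (normal_pdf 0 1 x)%:E).
Proof.
move=> mf f0; rewrite /stdnormal ge0_integral_distribution//.
exact: integral_normal.
Qed.

Lemma normal_pdf01 (x : R) :
  normal_pdf 0 1 x = (normal_peak 1 * expR (- x ^+ 2 / 2))%R.
Proof. by rewrite normal_pdfE ?oner_eq0// /normal_fun subr0 expr1n. Qed.

Lemma measurable_EFin_normal_pdf (m s : R) :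
  measurable_fun [set: R] (fun x => (normal_pdf m s x)%:E).
Proof. by apply/measurable_EFinP; exact: measurable_normal_pdf. Qed.

Lemma stdnormal_set1 (x : R) : stdnormal [set x] = 0.
Proof.
rewrite stdnormalE.
have /null_content_dominatesP := normal_prob_dominates 0 1 : normal_prob 0 1 `<< leb.
by apply => //; exact: lebesgue_measure_set1.
Qed.

Lemma normal_peak_scale (s : R) : (0 < s)%R -> (s * normal_peak s = normal_peak 1)%R.
Proof.
move=> s0; rewrite /normal_peak expr1n mul1r -mulrnAr sqrtrM ?sqr_ge0//.
by rewrite sqrtr_sqr gtr0_norm// invfM mulrA divff ?gt_eqF// mul1r.
Qed.

Lemma normal_prob_standardize (m s : R) (A : set R) : (0 < s)%R -> measurable A ->
  normal_prob m s ((fun x => (x - m) / s)%R @^-1` A) = stdnormal A.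
Proof.
move=> s0 mA.
have mg : measurable_fun setT (fun x : R => (x - m) / s)%R.
  by apply: measurable_funM => //; exact: measurable_funB.
have mB : measurable ((fun x => (x - m) / s)%R @^-1` A).
  by rewrite -[X in measurable X]setTI; exact: mg.
have E (m' s' : R) (B : set R) : measurable B ->
    normal_prob m' s' B = \int[leb]_x ((\1_B x)%:E * (normal_pdf m' s' x)%:E).
  move=> mB'; rewrite -integral_normal//=.
    by rewrite integral_indic// setIT.
  exact/measurable_EFinP.
rewrite stdnormalE (E m s _ mB) (E 0%R 1%R _ mA).
have s0' : s != 0%R by rewrite gt_eqF.
rewrite [LHS](integral_affine m s0')//=; last 2 first.
- apply: emeasurable_funM; apply/measurable_EFinP => //.
  exact: measurable_normal_pdf.
- by move=> x; rewrite mule_ge0// lee_fin ?normal_pdf_ge0.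
rewrite -ge0_integralZl_EFin//; last 2 first.
- by move=> x _; rewrite mule_ge0// lee_fin ?normal_pdf_ge0.
- have mh : measurable_fun [set: measurableTypeR R]
    (fun x => (\1_((fun x0 : R => (x0 - m) / s)%R @^-1` A) x)%:E * (normal_pdf m s x)%:E).
    apply: emeasurable_funM; apply/measurable_EFinP => //.
    exact: measurable_normal_pdf.
  exact: (measurableT_comp mh (measurable_affine s m)).
apply: eq_integral => x _ /=.
rewrite muleCA -EFinM; congr (_%:E * _%:E).
  have xE : ((s * x + m - m) / s = x)%R by rewrite addrK mulrAC divff// mul1r.
  rewrite !indicE; congr (_ %:R); congr nat_of_bool.
  by apply/idP/idP => /set_mem h; apply/mem_set; move: h; rewrite /= xE.
rewrite !normal_pdfE ?oner_eq0// /normal_fun addrK subr0 expr1n exprMn.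
rewrite mulrA gtr0_norm// normal_peak_scale//; congr (_ * expR _)%R.
by field.
Qed.

Lemma integral2_stdnormal (f : R * R -> \bar R) :
  measurable_fun setT f -> (forall x, 0 <= f x) ->
  \int[stdnormal]_x \int[stdnormal]_y f (x, y) =
  \int[leb]_x \int[leb]_y (f (x, y) * (normal_pdf 0 1 x * normal_pdf 0 1 y)%:E).
Proof.
move=> mf f0; rewrite integral_stdnormal; last 2 first.
- exact: (measurable_fun_fubini_tonelli_F f).
- by move=> x; exact: integral_ge0.
have mfx x : measurable_fun setT (fun y => f (x, y)).
  by apply: (measurableT_comp mf); exact: measurable_fun_pair.
apply: eq_integral => x _.
rewrite integral_stdnormal//.
rewrite muleC -ge0_integralZl_EFin//; last 3 first.
- by move=> y _; rewrite mule_ge0// lee_fin normal_pdf_ge0.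
- exact: (emeasurable_funM (mfx x) (measurable_EFin_normal_pdf 0 1)).
- exact: normal_pdf_ge0.
by apply: eq_integral => y _; rewrite EFinM muleCA.
Qed.

(** The product density is a function of x^2 + y^2, which the reflection preserves. *)
Lemma stdnormal_reflection (a b : R) (f : R * R -> \bar R) :
  (a ^+ 2 + b ^+ 2 = 1)%R -> measurable_fun setT f -> (forall x, 0 <= f x) ->
  \int[stdnormal]_x \int[stdnormal]_y f ((a * x + b * y)%R, (b * x - a * y)%R) =
  \int[stdnormal]_x \int[stdnormal]_y f (x, y).
Proof.
move=> ab1 mf f0.
rewrite (integral2_stdnormal
  (f := fun z => f ((a * z.1 + b * z.2)%R, (b * z.1 - a * z.2)%R)))//; last first.
  apply: (measurableT_comp mf); apply: measurable_fun_pair.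
    by apply: measurable_funD; exact: measurable_funM.
  by apply: measurable_funB; exact: measurable_funM.
rewrite [RHS](integral2_stdnormal mf f0).
pose h z := f z * (normal_pdf 0 1 z.1 * normal_pdf 0 1 z.2)%:E.
rewrite -[RHS](lebesgue_reflection (h := h) ab1).
- apply: eq_integral => x _; apply: eq_integral => y _; rewrite /h/=; congr (_ * _%:E).
  rewrite !normal_pdf01 !mulrA ![(normal_peak 1 * _ * normal_peak 1)%R]mulrAC.
  rewrite -!mulrA -!expRD; congr (_ * (_ * expR _))%R.
  transitivity (- ((a ^+ 2 + b ^+ 2) * x ^+ 2 + (a ^+ 2 + b ^+ 2) * y ^+ 2) / 2)%R.
    by rewrite ab1; field.
  by field.
- apply: emeasurable_funM => //; apply/measurable_EFinP.
  by apply: measurable_funM; exact: (measurableT_comp (measurable_normal_pdf 0 1)).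
- by move=> z; rewrite mule_ge0// lee_fin mulr_ge0// normal_pdf_ge0.
Qed.

(** The integrand times the standard density is a multiple of the normal density of variance 1 / k.
    The parameter 1 - k lets one statement serve the Chernoff bound (k <= 1) and the Laplace
    transform (k >= 1). *)
Lemma integral_expR_stdnormal (k : R) : (0 < k)%R ->
  \int[stdnormal]_x (expR ((1 - k) * x ^+ 2 / 2))%:E = ((Num.sqrt k)^-1)%:E.
Proof.
move=> k0; set s := (Num.sqrt k)^-1%R.
have s0 : (0 < s)%R by rewrite invr_gt0 sqrtr_gt0.
rewrite integral_stdnormal; last 2 first.
- apply/measurable_EFinP; apply: measurableT_comp => //.
  by apply: measurable_funM => //; apply: measurable_funM => //; exact: measurable_funX.
- by move=> x; rewrite lee_fin expR_ge0.
transitivity (\int[leb]_x (s%:E * (normal_pdf 0 s x)%:E)).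
  apply: eq_integral => x _; rewrite -!EFinM; congr (_%:E).
  rewrite normal_pdf01 normal_pdfE ?gt_eqF// /normal_fun subr0 mulrCA -expRD [RHS]mulrA.
  rewrite normal_peak_scale//; congr (_ * expR _)%R.
  have -> : (s ^+ 2 = k^-1)%R by rewrite /s exprVn sqr_sqrtr// ltW.
  by field; rewrite gt_eqF.
rewrite ge0_integralZl_EFin//.
- by rewrite integral_normal_pdf mule1.
- by move=> x _; rewrite lee_fin normal_pdf_ge0.
- apply/measurable_EFinP; exact: measurable_normal_pdf.
- exact: ltW.
Qed.

Lemma stdnormal_tail (e : R) : (0 < e)%R -> exists2 c : R, (0 < c)%R &
  forall x : R, (0 <= x)%R ->
  (c * expR (- ((1 + e) * x) / 2))%:E <= stdnormal [set z | x < z ^+ 2]%R.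
Proof.
(* On []r, r + 1]] with r = sqrt x the density is at least its value at r + 1, and 2 r <= e r^2 + 1
   / e bounds (r + 1)^2 by (1 + e) x + 1 + 1 / e. *)
move=> e0; exists (normal_peak 1 * expR (- (1 + e^-1) / 2))%R.
  by rewrite mulr_gt0 ?expR_gt0// normal_peak_gt0 ?oner_eq0.
move=> x x0; set r := Num.sqrt x.
have r0 : (0 <= r)%R by exact: sqrtr_ge0.
have mA : measurable [set z : R | x < z ^+ 2]%R.
  by apply: measurable_ltr_set => //; exact: measurable_funX.
apply: (@le_trans _ _ (stdnormal (`]r, (r + 1)%R]%classic : set R))); last first.
  apply: le_measure; rewrite ?inE//.
  move=> z; rewrite /= in_itv/= => /andP[rz _].
  by rewrite -[x]sqr_sqrtr// ltr_pXn2r// nnegrE ltW// (le_lt_trans r0).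
rewrite stdnormalE /normal_prob.
have -> : (normal_peak 1 * expR (- (1 + e^-1) / 2) * expR (- ((1 + e) * x) / 2))%:E =
   \int[leb]_(z in `]r, (r + 1)%R])
     (normal_peak 1 * expR (- (1 + e^-1) / 2) * expR (- ((1 + e) * x) / 2))%:E.
  rewrite integral_cst//= lebesgue_measure_itv/= lte_fin ltrDl ltr01.
  by rewrite -EFinB addrAC subrr add0r mule1.
apply: ge0_le_integral => //=.
- by move=> z _; rewrite lee_fin !mulr_ge0// ?expR_ge0// normal_peak_ge0.
- apply/measurable_EFinP; apply: measurable_funTS; exact: measurable_normal_pdf.
- move=> z; rewrite in_itv/= => /andP[rz zr].
  rewrite lee_fin normal_pdf01 -mulrA ler_wpM2l ?normal_peak_ge0// -expRD ler_expR.
  have -> : x = (r ^+ 2)%R by rewrite sqr_sqrtr.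
  have z2 : (z ^+ 2 <= (r + 1) ^+ 2)%R by rewrite ler_pXn2r// nnegrE; lra.
  have : (0 <= (e * r - 1) ^+ 2 / e)%R by rewrite divr_ge0 ?sqr_ge0// ltW.
  have -> : ((e * r - 1) ^+ 2 / e = e * r ^+ 2 - 2 * r + e^-1)%R by field; rewrite gt_eqF.
  nra.
Qed.

End stdnormal.

(** * Rotation invariance of the standard Gaussian vector *)

Section gauss.
Context {R : realType}.
Local Open Scope ereal_scope.

Lemma tuple_consE n (t : n.+1.-tuple R) :
  tuple_cons ([tuple of behead t], thead t) = t.
Proof. by rewrite [RHS]tuple_eta; apply/val_inj. Qed.

Lemma thead_tuple_cons n (vx : n.-tuple R * R) : thead (tuple_cons vx) = vx.2.
Proof. by rewrite /tuple_cons theadE. Qed.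

Lemma behead_tuple_cons n (vx : n.-tuple R * R) :
  [tuple of behead (tuple_cons vx)] = vx.1.
Proof. exact/val_inj. Qed.

Lemma inner_tuple_cons n (u v : n.-tuple R * R) :
  inner (tuple_cons u) (tuple_cons v) = (u.2 * v.2 + inner u.1 v.1)%R.
Proof.
rewrite /inner big_ord_recl !tuple_cons_tnth0; congr (_ + _)%R.
by apply: eq_bigr => i _; rewrite !tuple_cons_tnthS.
Qed.

Lemma innerS n (x y : n.+1.-tuple R) : inner x y =
  (thead x * thead y + inner [tuple of behead x] [tuple of behead y])%R.
Proof. by rewrite -{1}(tuple_consE x) -{1}(tuple_consE y) inner_tuple_cons. Qed.

Lemma measurable_inner d (T : measurableType d) n (f g : T -> n.-tuple R) :
  measurable_fun setT f -> measurable_fun setT g ->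
  measurable_fun setT (fun x => inner (f x) (g x)).
Proof.
move=> mf mg; apply: measurable_sum => i.
by apply: measurable_funM; apply: (measurableT_comp (measurable_tnth i)).
Qed.

Lemma measurable_thead n : measurable_fun [set: n.+1.-tuple R] (@thead n R).
Proof. exact: measurable_tnth. Qed.

Lemma inner_ge0 n (x : n.-tuple R) : (0 <= inner x x)%R.
Proof. by apply: sumr_ge0 => i _; rewrite -expr2 sqr_ge0. Qed.

Definition gauss n : probability (n.-tuple R) R :=
  tuple_prod (fun _ : 'I_n => @stdnormal R).

Lemma integral_gaussS n (f : n.+1.-tuple R -> \bar R) :
  measurable_fun [set: n.+1.-tuple R] f -> (forall x, 0 <= f x) ->
  \int[gauss n.+1]_x f x =
  \int[gauss n]_v \int[stdnormal]_x f (tuple_cons (v, x)).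
Proof. by move=> mf f0; rewrite /gauss tuple_prodS. Qed.

(** Orthogonality is encoded by preservation of inner products. Invariance of the measure is stated
    for integrals, the form that passes through the iterated integrals of the recursive product. *)
Definition gauss_isometry n (Q : n.-tuple R -> n.-tuple R) : Prop :=
  [/\ measurable_fun [set: n.-tuple R] Q,
      forall x y, inner (Q x) (Q y) = inner x y &
      forall f : n.-tuple R -> \bar R, measurable_fun [set: n.-tuple R] f ->
        (forall x, 0 <= f x) ->
        \int[gauss n]_x f (Q x) = \int[gauss n]_x f x].

Lemma gauss_isometry_id n : gauss_isometry (@id (n.-tuple R)).
Proof. by split. Qed.

Lemma gauss_isometry_comp n (Q1 Q2 : n.-tuple R -> n.-tuple R) :
  gauss_isometry Q1 -> gauss_isometry Q2 -> gauss_isometry (Q1 \o Q2).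
Proof.
move=> [m1 i1 g1] [m2 i2 g2]; split.
- exact: measurableT_comp m1 m2.
- by move=> x y /=; rewrite i1 i2.
- move=> f mf f0 /=; rewrite (g2 (fun x => f (Q1 x)))//; first exact: g1.
  exact: measurableT_comp mf m1.
Qed.

Lemma measurable_tuple_cons2 d (T : measurableType d) n (f : T -> n.-tuple R) (g : T -> R) :
  measurable_fun setT f -> measurable_fun setT g ->
  measurable_fun setT (fun x => tuple_cons (f x, g x)).
Proof.
move=> mf mg; apply: (measurableT_comp (@measurable_tuple_cons _ _ n)).
exact: measurable_fun_pair.
Qed.

Lemma measurable_integral_tuple_cons n (f : n.+1.-tuple R -> \bar R) :
  measurable_fun [set: n.+1.-tuple R] f -> (forall x, 0 <= f x) ->
  measurable_fun [set: n.-tuple R] (fun v => \int[stdnormal]_x f (tuple_cons (v, x))).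
Proof.
move=> mf f0.
apply: (measurable_fun_fubini_tonelli_F (fun vx : n.-tuple R * R => f (tuple_cons vx))) => //.
exact: measurableT_comp mf (@measurable_tuple_cons _ _ n).
Qed.

Definition tuple_lift n (Q : n.-tuple R -> n.-tuple R) (x : n.+1.-tuple R) :
  n.+1.-tuple R := tuple_cons (Q [tuple of behead x], thead x).

Lemma gauss_isometry_lift n (Q : n.-tuple R -> n.-tuple R) :
  gauss_isometry Q -> gauss_isometry (tuple_lift Q).
Proof.
move=> [mQ iQ gQ]; have mL : measurable_fun setT (tuple_lift Q).
  apply: measurable_tuple_cons2; last exact: measurable_thead.
  exact: (measurableT_comp mQ (@measurable_behead _ _ n)).
split => //.
- by move=> x y; rewrite inner_tuple_cons/= iQ [RHS]innerS.
- move=> f mf f0; rewrite (integral_gaussS (f := fun x => f (tuple_lift Q x)))//; last first.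
    exact: measurableT_comp mf mL.
  rewrite [RHS](integral_gaussS mf f0).
  rewrite -[RHS](gQ (fun v => \int[stdnormal]_x f (tuple_cons (v, x)))).
  + apply: eq_integral => v _; apply: eq_integral => x _.
    by rewrite /tuple_lift behead_tuple_cons thead_tuple_cons.
  + exact: measurable_integral_tuple_cons.
  + by move=> v; exact: integral_ge0.
Qed.

(** On the first two coordinates this is the matrix with rows (-a, b) and (b, a), a reflection when
    a^2 + b^2 = 1. *)
Definition reflect2 n (a b : R) (x : n.+2.-tuple R) : n.+2.-tuple R :=
  let y := [tuple of behead x] in
  tuple_cons (tuple_cons ([tuple of behead y], a * thead y + b * thead x),
     b * thead y - a * thead x)%R.

Lemma gauss_isometry_reflect2 n (a b : R) : (a ^+ 2 + b ^+ 2 = 1)%R ->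
  gauss_isometry (@reflect2 n a b).
Proof.
move=> ab1; have mL : measurable_fun setT (@reflect2 n a b).
  have m1 : measurable_fun setT (fun x : n.+2.-tuple R => thead x) := @measurable_thead _.
  have mb : measurable_fun setT (fun x : n.+2.-tuple R => [tuple of behead x]) :=
    @measurable_behead _ _ _.
  have m2 : measurable_fun setT (fun x : n.+2.-tuple R => thead [tuple of behead x]).
    exact: measurableT_comp (@measurable_thead _) mb.
  apply: measurable_tuple_cons2; last first.
    by apply: measurable_funB; exact: measurable_funM.
  apply: measurable_tuple_cons2; last first.
    by apply: measurable_funD; exact: measurable_funM.
  exact: measurableT_comp (@measurable_behead _ _ _) mb.
split => //.
- move=> x y; rewrite !inner_tuple_cons/= [RHS]innerS [in RHS]innerS.
  rewrite [RHS]addrA addrA; congr (_ + _)%R.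
  set x0 := thead x; set y0 := thead y; set x1 := thead _; set y1 := thead _.
  transitivity ((a ^+ 2 + b ^+ 2) * (x0 * y0 + x1 * y1))%R; first by ring.
  by rewrite ab1 mul1r.
- move=> f mf f0; rewrite (integral_gaussS (f := fun x => f (reflect2 a b x)))//; last first.
    exact: measurableT_comp mf mL.
  rewrite integral_gaussS; last 2 first.
  + exact: (measurable_integral_tuple_cons (f := f \o reflect2 a b)
      (measurableT_comp mf mL) (fun=> f0 _)).
  + by move=> v; exact: integral_ge0.
  rewrite [RHS](integral_gaussS mf f0) [RHS]integral_gaussS; last 2 first.
  + exact: measurable_integral_tuple_cons.
  + by move=> v; exact: integral_ge0.
  apply: eq_integral => v _.
  have mfv : measurable_fun setT (fun z : R * R => f (tuple_cons (tuple_cons (v, z.1), z.2))).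
    apply: (measurableT_comp mf); apply: measurable_tuple_cons2 => //.
    by apply: measurable_tuple_cons2.
  apply: etrans (stdnormal_reflection ab1 mfv (fun=> f0 _)).
  apply: eq_integral => x _; apply: eq_integral => y _.
  by rewrite /reflect2 !behead_tuple_cons !thead_tuple_cons.
Qed.

(** Coordinates are absorbed one at a time: an isometry of the tail aligns the tail with its own
    first axis, and a planar reflection merges that axis with the remaining coordinate. A factor r
    of either sign, possibly 0, also covers x = 0. *)
Lemma gauss_align n (x : n.+1.-tuple R) : exists Q r,
  [/\ gauss_isometry Q, (r ^+ 2 = inner x x)%R &
      forall y, inner x y = (r * thead (Q y))%R].
Proof.
elim: n x => [|n IH] x.
  exists id, (thead x); split.
  - exact: gauss_isometry_id.
  - by rewrite innerS [X in (_ + X)%R]/inner big_ord0 addr0 expr2.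
  - by move=> y; rewrite innerS [X in (_ + X)%R]/inner big_ord0 addr0.
have [Q [r [gQ r2 hQ]]] := IH [tuple of behead x].
pose s := Num.sqrt (thead x ^+ 2 + r ^+ 2).
have s2 : (s ^+ 2 = thead x ^+ 2 + r ^+ 2)%R.
  by rewrite sqr_sqrtr// addr_ge0 ?sqr_ge0.
have [s0|s0] := eqVneq s 0%R.
  have /eqP : (thead x ^+ 2 + r ^+ 2 = 0)%R by rewrite -s2 s0 expr0n.
  rewrite paddr_eq0 ?sqr_ge0// !sqrf_eq0 => /andP[/eqP x0 /eqP r0].
  exists id, 0%R; split.
  - exact: gauss_isometry_id.
  - by rewrite innerS -r2 x0 r0 mul0r expr0n addr0.
  - by move=> y; rewrite innerS hQ x0 r0 !mul0r addr0.
(* This reflection sends ([thead x], r) to (s, 0). *)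
exists (reflect2 (- (thead x / s)) (r / s) \o tuple_lift Q), s; split.
- apply: gauss_isometry_comp; last exact: gauss_isometry_lift.
  apply: gauss_isometry_reflect2.
  by rewrite sqrrN !expr_div_n -mulrDl -s2 divff// sqrf_eq0.
- by rewrite s2 r2 [RHS]innerS expr2.
- move=> y; rewrite innerS hQ /= /reflect2 thead_tuple_cons/=.
  rewrite /tuple_lift behead_tuple_cons thead_tuple_cons/=.
  by field.
Qed.

End gauss.

(** * Gaussian measure of a spherical cap *)

(** The double cone over two opposite caps of the sphere. Being invariant under scaling, it has the
    Gaussian measure that these caps have under the uniform law. *)
Definition cap {R : realType} (k : nat) (t : R) : set (k.+1.-tuple R) :=
  [set z | t ^+ 2 * inner z z < thead z ^+ 2].
Arguments cap {R} k t.

Section gauss_cap.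
Context {R : realType}.
Local Open Scope ereal_scope.

Lemma gauss_isometry_preimage n (Q : n.-tuple R -> n.-tuple R) (A : set (n.-tuple R)) :
  gauss_isometry Q -> measurable A -> gauss n (Q @^-1` A) = gauss n A.
Proof.
move=> [mQ _ gQ] mA.
have mQA : measurable (Q @^-1` A) by rewrite -[X in measurable X]setTI; exact: mQ.
rewrite -[X in gauss n X = _]setIT -[X in _ = gauss n X]setIT -!integral_indic//.
rewrite -[RHS]gQ//.
by apply/measurable_EFinP; exact: measurable_indic.
Qed.

Lemma gauss_preimage_behead n (A : set (n.-tuple R)) : measurable A ->
  gauss n.+1 [set z : n.+1.-tuple R | A [tuple of behead z]] = gauss n A.
Proof.
move=> mA.
have mB : measurable [set z : n.+1.-tuple R | A [tuple of behead z]].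
  by rewrite -[X in measurable X]setTI; exact: (@measurable_behead _ _ n).
rewrite -[X in _ = gauss n X]setIT -[X in gauss n.+1 X = _]setIT -!integral_indic//.
rewrite integral_gaussS//; last by apply/measurable_EFinP; exact: measurable_indic.
apply: eq_integral => v _.
rewrite (eq_integral (cst (\1_A v)%:E)); last first.
  move=> x _; rewrite /= !indicE; congr (_ %:R%:E); congr nat_of_bool.
  by apply/idP/idP => /set_mem h; apply/mem_set; move: h; rewrite /= behead_tuple_cons.
by rewrite integral_cst//= probability_setT mule1.
Qed.

Lemma measurable_inner_lt n (t : R) (x : n.-tuple R) :
  measurable [set z : n.-tuple R | t ^+ 2 * inner z z < inner x z ^+ 2]%R.
Proof.
apply: measurable_ltr_set.
  by apply: measurable_funM => //; exact: measurable_inner.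
by apply: measurable_funX; exact: measurable_inner.
Qed.

Lemma measurable_cap k (t : R) : measurable (cap k t).
Proof.
apply: measurable_ltr_set.
  by apply: measurable_funM => //; exact: measurable_inner.
by apply: measurable_funX; exact: measurable_thead.
Qed.

Lemma gauss_cap_rotate k (t : R) (x : k.+1.-tuple R) : (inner x x = 1)%R ->
  gauss k.+1 [set z | t ^+ 2 * inner z z < inner x z ^+ 2]%R = gauss k.+1 (cap k t).
Proof.
move=> x1; have [Q [r [gQ r2 hQ]]] := gauss_align x.
rewrite -(gauss_isometry_preimage gQ (@measurable_cap k t)); congr (gauss _ _).
have [_ iQ _] := gQ.
by apply/seteqP; split => z /=; rewrite /cap/= iQ hQ exprMn r2 x1 mul1r.
Qed.

(** Q takes the all-ones vector to the first axis, so the head of [Q z] is, up to sign, the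
    normalized sum of z, and the other coordinates carry the centred vector. Centring thus costs one
    dimension, whence n - 2 in place of n - 1. *)
Lemma gauss_center k : exists Q : k.+2.-tuple R -> k.+2.-tuple R,
  [/\ gauss_isometry Q,
      forall z, (inner z z - (\sum_(i < k.+2) tnth z i) ^+ 2 / k.+2%:R =
        inner [tuple of behead (Q z)] [tuple of behead (Q z)])%R &
      forall y z, (\sum_(i < k.+2) tnth y i = 0)%R ->
        inner y z = inner [tuple of behead (Q y)] [tuple of behead (Q z)]].
Proof.
pose e : k.+2.-tuple R := [tuple 1%R | i < k.+2].
have [Q [r [gQ r2 hQ]]] := gauss_align e.
have [_ iQ _] := gQ.
have sumE z : (\sum_(i < k.+2) tnth z i = r * thead (Q z))%R.
  by rewrite -hQ; apply: eq_bigr => i _; rewrite tnth_mktuple mul1r.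
have {}r2 : (r ^+ 2 = k.+2%:R)%R.
  rewrite r2 /inner (eq_bigr (fun=> 1%R)).
    by rewrite sumr_const card_ord.
  by move=> i _; rewrite tnth_mktuple mul1r.
have r0 : (r != 0)%R by rewrite -sqrf_eq0 r2 pnatr_eq0.
exists Q; split => // [z|y z].
  rewrite sumE exprMn r2 mulrAC divff ?pnatr_eq0// mul1r -iQ innerS expr2.
  by rewrite addrAC subrr add0r.
rewrite sumE => /eqP; rewrite mulf_eq0 (negbTE r0)/= => /eqP Qy0.
by rewrite -iQ innerS Qy0 mul0r add0r.
Qed.

Lemma gauss_cap_center k (t : R) (y : k.+2.-tuple R) :
  (\sum_(i < k.+2) tnth y i = 0)%R -> (inner y y = 1)%R ->
  gauss k.+2 [set z | t ^+ 2 * (inner z z - (\sum_(i < k.+2) tnth z i) ^+ 2 / k.+2%:R)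
                     < inner y z ^+ 2]%R = gauss k.+1 (cap k t).
Proof.
move=> y0 y1; have [Q [gQ hQ1 hQ2]] := gauss_center k.
pose y' : k.+1.-tuple R := [tuple of behead (Q y)].
rewrite -(@gauss_cap_rotate _ _ y'); last by rewrite -hQ2.
rewrite -[RHS]gauss_preimage_behead; last exact: measurable_inner_lt.
rewrite -[RHS](gauss_isometry_preimage gQ).
  by congr (gauss _ _); apply/seteqP; split => z /=; rewrite hQ1 (hQ2 y z y0).
rewrite -[X in measurable X]setTI; apply: (@measurable_behead _ _ k.+1) => //.
exact: measurable_inner_lt.
Qed.

(** The set lies in the hyperplane of vanishing first coordinate, which is null because the normal
    law has no atoms. *)
Lemma gauss_inner_eq0 k : gauss k.+1 [set z : k.+1.-tuple R | inner z z = 0]%R = 0.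
Proof.
have m0 : measurable [set z : k.+1.-tuple R | inner z z = 0%R].
  by apply: measurable_eqr_set; exact: measurable_inner.
apply/eqP; rewrite eq_le measure_ge0 andbT.
have <- : gauss k.+1 [set z : k.+1.-tuple R | [set 0%R : R] (tnth z ord0)] = 0.
  exact: etrans (tuple_prod_marginal _ ord0 (measurable_set1 0%R)) (stdnormal_set1 0%R).
apply: le_measure; rewrite ?inE//.
  by rewrite -[X in measurable X]setTI; exact: measurable_tnth.
move=> z /= /eqP; rewrite innerS paddr_eq0 ?inner_ge0 -?expr2 ?sqr_ge0//.
by rewrite sqrf_eq0 => /andP[/eqP].
Qed.

Lemma gauss_center_eq0 k :
  gauss k.+2 [set z : k.+2.-tuple R |
    inner z z - (\sum_(i < k.+2) tnth z i) ^+ 2 / k.+2%:R = 0]%R = 0.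
Proof.
have [Q [gQ hQ1 hQ2]] := gauss_center k.
have m0 : measurable [set z : k.+1.-tuple R | inner z z = 0%R].
  by apply: measurable_eqr_set; exact: measurable_inner.
have mb : measurable [set z : k.+2.-tuple R | [set z | inner z z = 0%R] [tuple of behead z]].
  by rewrite -[X in measurable X]setTI; exact: (@measurable_behead _ _ k.+1).
apply: etrans (etrans (gauss_preimage_behead m0) (gauss_inner_eq0 k)).
rewrite -(gauss_isometry_preimage gQ mb).
by congr (gauss _ _); apply/seteqP; split => z /=; rewrite hQ1.
Qed.

(** In other parameters, the Laplace transform of the chi-square law with n degrees of freedom; the
    coordinates factor. *)
Lemma integral_expR_gauss n (k : R) : (0 < k)%R ->
  \int[gauss n]_v (expR ((1 - k) * inner v v / 2))%:E = ((Num.sqrt k)^-1 ^+ n)%:E.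
Proof.
move=> k0.
have mE (m : nat) : measurable_fun [set: m.-tuple R]
    (fun v => (expR ((1 - k) * inner v v / 2))%:E).
  apply/measurable_EFinP; apply: measurableT_comp => //.
  by apply: measurable_funM => //; apply: measurable_funM => //; exact: measurable_inner.
elim: n => [|n IH].
  rewrite expr0 (eq_integral (cst 1%:E)).
    by rewrite integral_cst//= probability_setT mule1.
  by move=> v _; rewrite /inner big_ord0 mulr0 mul0r expR0.
rewrite integral_gaussS//.
under eq_integral => v _.
  under eq_integral => x _.
    rewrite inner_tuple_cons/= -expr2 mulrDr mulrDl addrC expRD EFinM; over.
  rewrite ge0_integralZl_EFin//; last first.
    by apply/measurable_EFinP; apply: measurableT_comp => //;
       apply: measurable_funM => //; apply: measurable_funM => //; exact: measurable_funX.
  rewrite integral_expR_stdnormal// muleC; over.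
rewrite ge0_integralZl_EFin//.
  by rewrite IH exprS EFinM.
exact: mE.
Qed.

Lemma gauss_capE k (t : R) : (t ^+ 2 < 1)%R ->
  gauss k.+1 (cap k t) =
  \int[gauss k]_v stdnormal [set x | t ^+ 2 / (1 - t ^+ 2) * inner v v < x ^+ 2]%R.
Proof.
move=> t1; have mc := @measurable_cap k t.
rewrite -[X in gauss _ X]setIT -integral_indic//.
rewrite integral_gaussS//; last by apply/measurable_EFinP; exact: measurable_indic.
apply: eq_integral => v _.
set B := [set x | _]%R.
have mB : measurable B by apply: measurable_ltr_set => //; exact: measurable_funX.
rewrite -[X in stdnormal X]setIT -integral_indic//.
apply: eq_integral => x _; rewrite !indicE; congr (_ %:R%:E); congr nat_of_bool.
suff E : cap k t (tuple_cons (v, x)) = B x.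
  by apply/idP/idP => /set_mem h; apply/mem_set; move: h; rewrite E.
have -> : B x = (t ^+ 2 / (1 - t ^+ 2) * inner v v < x ^+ 2)%R :> Prop by [].
rewrite mulrAC ltr_pdivrMr ?subr_gt0//.
rewrite /cap/= inner_tuple_cons thead_tuple_cons/=.
congr is_true; rewrite -[LHS]subr_gt0 -[RHS]subr_gt0; congr (_ < _)%R.
by ring.
Qed.

Lemma measurable_stdnormal_inner k (s : R) :
  measurable_fun [set: k.-tuple R]
    (fun v => stdnormal [set x | s * inner v v < x ^+ 2]%R).
Proof.
pose A := [set vx : k.-tuple R * R | s * inner vx.1 vx.1 < vx.2 ^+ 2]%R.
have mA : measurable A.
  apply: measurable_ltr_set; last by apply: measurable_funX.
  by apply: measurable_funM => //; exact: measurable_inner.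
rewrite (_ : (fun _ => _) = @stdnormal R \o xsection A).
  exact: measurable_fun_xsection.
apply/funext => v /=; congr (stdnormal _); apply/seteqP; split => x.
  by move=> h; apply: mem_set.
by move/set_mem.
Qed.

(** Chernoff bound: the indicator of y < x^2 is at most exp ((1 - e)(x^2 - y) / 2). *)
Lemma stdnormal_tail_le (e y : R) : (0 < e <= 1)%R ->
  stdnormal [set x | y < x ^+ 2]%R <= ((Num.sqrt e)^-1 * expR (- ((1 - e) * y) / 2))%:E.
Proof.
move=> /andP[e0 e1].
set B := [set x | _]%R.
have mB : measurable B by apply: measurable_ltr_set => //; exact: measurable_funX.
have mE : measurable_fun [set: R] (fun x => (expR ((1 - e) * x ^+ 2 / 2))%:E).
  apply/measurable_EFinP; apply: measurableT_comp => //.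
  by apply: measurable_funM => //; apply: measurable_funM => //; exact: measurable_funX.
rewrite -[X in stdnormal X]setIT -integral_indic// mulrC EFinM.
rewrite -integral_expR_stdnormal// -ge0_integralZl_EFin ?expR_ge0//.
apply: ge0_le_integral => //.
- exact/measurable_EFinP/measurable_indic.
- by apply: emeasurable_funM => //.
move=> x _; rewrite -EFinM lee_fin -expRD indicE.
case: (boolP (x \in B)) => [/set_mem/= xB|_]; last exact: expR_ge0.
rewrite -[leLHS]expR0 ler_expR -mulrDl divr_ge0// addrC -mulrBr mulr_ge0 ?subr_ge0//.
exact: ltW.
Qed.

Lemma gauss_cap_le (e : R) : (0 < e <= 1)%R -> exists2 C : R, (0 < C)%R &
  forall k (t : R), (t ^+ 2 < 1)%R ->
  gauss k.+1 (cap k t) <=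
  (C * (Num.sqrt (1 + (1 - e) * (t ^+ 2 / (1 - t ^+ 2))))^-1 ^+ k)%:E.
Proof.
move=> /andP[e0 e1]; exists (Num.sqrt e)^-1%R; first by rewrite invr_gt0 sqrtr_gt0.
move=> k t t1; rewrite gauss_capE//; set s := (t ^+ 2 / _)%R.
have s0 : (0 <= s)%R by rewrite divr_ge0 ?sqr_ge0// subr_ge0 ltW.
have k0 : (0 < 1 + (1 - e) * s)%R by rewrite ltr_wpDr// mulr_ge0// subr_ge0.
have mE : measurable_fun [set: k.-tuple R]
    (fun v => (expR ((1 - (1 + (1 - e) * s)) * inner v v / 2))%:E).
  apply/measurable_EFinP; apply: measurableT_comp => //.
  by apply: measurable_funM => //; apply: measurable_funM => //; exact: measurable_inner.
rewrite EFinM -integral_expR_gauss// -ge0_integralZl_EFin ?invr_ge0 ?sqrtr_ge0//.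
apply: ge0_le_integral => //.
- exact: measurable_stdnormal_inner.
- exact: emeasurable_funM.
move=> v _; rewrite -EFinM.
have ee : (0 < e <= 1)%R by rewrite e0.
apply: le_trans (stdnormal_tail_le _ ee) _.
rewrite lee_fin le_eqVlt; apply/orP; left; apply/eqP; congr (_ * expR _)%R.
by field.
Qed.

Lemma gauss_cap_ge (e : R) : (0 < e)%R -> exists2 c : R, (0 < c)%R &
  forall k (t : R), (t ^+ 2 < 1)%R ->
  (c * (Num.sqrt (1 + (1 + e) * (t ^+ 2 / (1 - t ^+ 2))))^-1 ^+ k)%:E <=
  gauss k.+1 (cap k t).
Proof.
move=> e0; have [c c0 hc] := stdnormal_tail e0; exists c => //.
move=> k t t1; rewrite gauss_capE//; set s := (t ^+ 2 / _)%R.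
have s0 : (0 <= s)%R by rewrite divr_ge0 ?sqr_ge0// subr_ge0 ltW.
have k0 : (0 < 1 + (1 + e) * s)%R by rewrite ltr_wpDr// mulr_ge0// addr_ge0// ltW.
have mE : measurable_fun [set: k.-tuple R]
    (fun v => (expR ((1 - (1 + (1 + e) * s)) * inner v v / 2))%:E).
  apply/measurable_EFinP; apply: measurableT_comp => //.
  by apply: measurable_funM => //; apply: measurable_funM => //; exact: measurable_inner.
rewrite EFinM -integral_expR_gauss// -ge0_integralZl_EFin ?(ltW c0)//.
apply: ge0_le_integral => //.
- by move=> v _; rewrite -EFinM lee_fin mulr_ge0 ?expR_ge0 ?(ltW c0).
- exact: emeasurable_funM.
- exact: measurable_stdnormal_inner.
move=> v _; rewrite -EFinM.
apply: le_trans (hc _ _); last by rewrite mulr_ge0// inner_ge0.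
rewrite lee_fin le_eqVlt; apply/orP; left; apply/eqP; congr (_ * expR _)%R.
by field.
Qed.

Lemma gauss_cap_ge1 k (t : R) : (1 <= t ^+ 2)%R -> gauss k.+1 (cap k t) = 0.
Proof.
move=> t1; rewrite (_ : cap k t = set0) ?measure0// -subset0 => z; rewrite /cap/= innerS.
apply/negP; rewrite -leNgt -expr2 mulrDr.
apply: ler_wpDr; first by rewrite mulr_ge0 ?sqr_ge0// inner_ge0.
by rewrite ler_peMl// sqr_ge0.
Qed.

End gauss_cap.

(** * Tail estimates at the radius *)

Section cap_radius.
Context {R : realType}.

(** Divided by exp (d x), the right side averages exp over the points - d x and (1 - d) x, whose
    weighted mean is 0; the tangent bound 1 + y <= exp y makes this average at least 1. *)
Lemma expR_convex01 (x d : R) : 0 <= d <= 1 -> expR (d * x) <= 1 - d + d * expR x.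
Proof.
move=> /andP[d0 d1].
have h1 := expR_ge1Dx (- (d * x)); have h2 := expR_ge1Dx ((1 - d) * x).
have : 1 <= (1 - d) * expR (- (d * x)) + d * expR ((1 - d) * x).
  apply: (@le_trans _ _ ((1 - d) * (1 + - (d * x)) + d * (1 + (1 - d) * x))).
    by rewrite le_eqVlt; apply/orP; left; apply/eqP; ring.
  by rewrite lerD// ler_wpM2l// subr_ge0.
rewrite -(ler_pM2r (expR_gt0 (d * x))) mul1r mulrDl -!mulrA -!expRD.
have -> : - (d * x) + d * x = 0 by ring.
have -> : (1 - d) * x + d * x = x by ring.
by rewrite expR0 mulr1.
Qed.

(* With x = 2 / k * ln p and T = t ^+ 2 the squared radius of the cap, the two
   next lemmas compare p ^ (2 / k) with the base of the power k / 2 in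
   gauss_cap_le and gauss_cap_ge. *)
Lemma upper_ratio (x d : R) (T := (1 + d) * (1 - expR (- x))) (e := d / 2 / (1 + d)) :
  0 < d < 1 -> 0 <= x -> T < 1 ->
  expR ((1 + d / 2) * x) <= 1 + (1 - e) * (T / (1 - T)).
Proof.
move=> /andP[d0 d1] x0 T1.
(* In terms of u, 1 - exp (- x) = u / (1 + u), and T < 1 says d u < 1; the choice of e makes e T =
   (d / 2) u / (1 + u). With m = 1 - d u / 2 the chain is (1 - e T) / (1 - T) >= m (1 + u) / (1 - d
   u) >= (1 + u) / m >= exp (x + d u / 2), where the middle step is m^2 >= 1 - d u and the last one
   m <= exp (- d u / 2). *)
pose u := expR x - 1.
have ux : x <= u by have := expR_ge1Dx x; rewrite /u; lra.
have u0 : 0 <= u by exact: le_trans ux.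
have aE : expR (- x) = (1 + u)^-1 by rewrite expRN /u addrC subrK.
have u1 : 0 < 1 + u by lra.
have TE : 1 - T = (1 - d * u) / (1 + u) by rewrite /T aE; field; rewrite gt_eqF.
have D0 : 0 < 1 - d * u.
  by have : 0 < 1 - T; [lra|rewrite TE pmulr_lgt0// invr_gt0].
pose m := 1 - d / 2 * u.
have m0 : 0 < m by rewrite /m; nra.
have -> : 1 + (1 - e) * (T / (1 - T)) = (1 - e * T) / (1 - T).
  by field; rewrite gt_eqF// subr_gt0.
have eT : e * T = d / 2 * (u / (1 + u)).
  by rewrite /e /T aE; field; rewrite !gt_eqF//; lra.
have eTm : m <= 1 - e * T.
  rewrite eT /m; have : u / (1 + u) <= u by rewrite ler_pdivrMr//; nra.
  nra.
apply: (@le_trans _ _ (m / (1 - T))); last first.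
  by rewrite ler_wpM2r// invr_ge0 subr_ge0 ltW.
apply: (@le_trans _ _ ((1 + u) / m)); last first.
  have -> : m / (1 - T) = (1 + u) * (m / (1 - d * u)).
    by rewrite TE; field; rewrite !gt_eqF.
  rewrite ler_wpM2l ?(ltW u1)// ler_pdivlMr// mulrC ler_pdivrMr// /m; nra.
have -> : (1 + d / 2) * x = x + d / 2 * x by ring.
rewrite expRD; have -> : expR x = 1 + u by rewrite /u; ring.
rewrite ler_wpM2l ?(ltW u1)// -[leLHS]invrK lef_pV2 ?posrE ?invr_gt0 ?expR_gt0//.
rewrite -expRN; apply: (@le_trans _ _ (expR (- (d / 2 * u)))); first exact: expR_ge1Dx.
by rewrite ler_expR lerN2 ler_wpM2l// divr_ge0// ltW.
Qed.

Lemma lower_ratio (x d : R) (T := (1 - d) * (1 - expR (- x))) (e := d / 2) :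
  0 < d < 1 -> 0 <= x ->
  1 + (1 + e) * (T / (1 - T)) <= expR ((1 - d / 2) * x).
Proof.
move=> /andP[d0 d1] x0.
have a1 : expR (- x) <= 1 by rewrite -expR0 ler_expR; lra.
have a0 := expR_gt0 (- x).
have T1 : 0 < 1 - T by rewrite /T; nra.
have -> : 1 + (1 + e) * (T / (1 - T)) = (1 + e * T) / (1 - T).
  by field; rewrite gt_eqF.
rewrite ler_pdivrMr//.
(* The numerator is controlled by 1 - exp (- x) <= x. *)
have h1 : 1 + e * T <= expR (d / 2 * x).
  apply: le_trans (expR_ge1Dx _); rewrite lerD2l /e ler_wpM2l//; first lra.
  have := expR_ge1Dx (- x); rewrite /T; nra.
apply: le_trans h1 _.
(* Convexity: 1 - T = d + (1 - d) exp (- x) averages exp over 0 and - x. The exponents d / 2 and 1 -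
   d then add up to 1 - d / 2. *)
have h2 : expR ((d - 1) * x) <= 1 - T.
  have -> : (d - 1) * x = d * x + - x by ring.
  rewrite expRD; have d01 : 0 <= d <= 1 by lra.
  have := expR_convex01 x d01.
  rewrite -(ler_pM2r a0) mulrDl -mulrA expRxMexpNx_1 /T; lra.
apply: (@le_trans _ _ (expR ((1 - d / 2) * x) * expR ((d - 1) * x))).
  by rewrite -expRD ler_expR; lra.
by rewrite ler_wpM2l// expR_ge0.
Qed.

Lemma powR_sphere (k p : nat) : (0 < p)%N ->
  p%:R `^ (- (2 / k%:R)) = expR (- (2 / k%:R * ln p%:R)) :> R.
Proof. by move=> p0; rewrite /powR gt_eqF ?ltr0n// mulNr. Qed.

(** The dimension cancels here: the k-th power undoes the root p^(2/k) of the radius. *)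
Lemma sqrt_exprN (x : R) (k : nat) : (0 < k)%N ->
  ((Num.sqrt (expR (2 / k%:R * x)))^-1) ^+ k = expR (- x).
Proof.
move=> k0; have -> : 2 / k%:R * x = (x / k%:R) *+ 2 by rewrite -mulr_natl; ring.
rewrite -mulr_natl expRM_natl sqrtr_sqr ger0_norm ?expR_ge0// -expRN -expRM_natl.
by rewrite mulrN mulrC divfK// pnatr_eq0 -lt0n.
Qed.

Lemma cap_radius_gt (d : R) : 0 < d < 1 -> exists2 C : R, 0 < C &
  forall (k p : nat) (t : R), (0 < k)%N -> (0 < p)%N ->
  t ^+ 2 = (1 + d) * (1 - p%:R `^ (- (2 / k%:R))) ->
  (gauss k.+1 (cap k t) <= (C * expR (- ((1 + d / 2) * ln p%:R)))%:E)%E.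
Proof.
move=> d01; have /andP[d0 d1] := d01.
pose e := d / 2 / (1 + d).
have e01 : 0 < e <= 1.
  by rewrite divr_gt0 ?divr_gt0 ?addr_gt0//= ler_pdivrMr; lra.
have [C C0 hC] := gauss_cap_le e01; exists C => // k p t k0 p0 tE.
have l0 : 0 <= ln (p%:R : R) by rewrite ln_ge0// ler1n.
(* The inflated radius may reach 1; the cap is then empty. *)
have [t1|t1] := leP 1 (t ^+ 2).
  by rewrite gauss_cap_ge1// lee_fin mulr_ge0 ?expR_ge0// ltW.
apply: le_trans (hC _ _ t1) _; rewrite lee_fin ler_wpM2l ?(ltW C0)//.
rewrite -(sqrt_exprN _ k0) lerXn2r ?nnegrE ?invr_ge0 ?sqrtr_ge0//.
have x0 : 0 <= 2 / k%:R * ln (p%:R : R) by rewrite mulr_ge0// divr_ge0.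
rewrite powR_sphere// in tE.
have h := @upper_ratio (2 / k%:R * ln (p%:R : R)) d d01 x0.
rewrite -tE in h; have {}h := h t1.
have s0 := lt_le_trans (expR_gt0 _) h.
have -> : 2 / k%:R * ((1 + d / 2) * ln p%:R) = (1 + d / 2) * (2 / k%:R * ln (p%:R : R)).
  by rewrite mulrCA.
rewrite lef_pV2 ?posrE ?sqrtr_gt0 ?expR_gt0//.
exact: ler_wsqrtr.
Qed.

Lemma cap_radius_lt (d : R) : 0 < d < 1 -> exists2 c : R, 0 < c &
  forall (k p : nat) (t : R), (0 < k)%N -> (0 < p)%N ->
  t ^+ 2 = (1 - d) * (1 - p%:R `^ (- (2 / k%:R))) ->
  ((c * expR (- ((1 - d / 2) * ln p%:R)))%:E <= gauss k.+1 (cap k t))%E.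
Proof.
move=> d01; have /andP[d0 d1] := d01.
have e0 : 0 < d / 2 by rewrite divr_gt0.
have [c c0 hc] := gauss_cap_ge e0; exists c => // k p t k0 p0 tE.
have l0 : 0 <= ln (p%:R : R) by rewrite ln_ge0// ler1n.
have x0 : 0 <= 2 / k%:R * ln (p%:R : R) by rewrite mulr_ge0// divr_ge0.
rewrite powR_sphere// in tE.
have t1 : t ^+ 2 < 1.
  have := expR_gt0 (- (2 / k%:R * ln (p%:R : R))); rewrite tE.
  have : expR (- (2 / k%:R * ln (p%:R : R))) <= 1.
    by rewrite -[leRHS]expR0 ler_expR oppr_le0.
  nra.
apply: le_trans (hc _ _ t1); rewrite lee_fin ler_wpM2l ?(ltW c0)//.
rewrite -(sqrt_exprN _ k0) lerXn2r ?nnegrE ?invr_ge0 ?sqrtr_ge0//.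
have h := @lower_ratio (2 / k%:R * ln (p%:R : R)) d d01 x0.
rewrite -tE in h.
have s0 : 0 < 1 + (1 + d / 2) * (t ^+ 2 / (1 - t ^+ 2)).
  by rewrite ltr_wpDr// mulr_ge0 ?addr_ge0 ?(ltW e0)// divr_ge0 ?sqr_ge0// subr_ge0 ltW.
have -> : 2 / k%:R * ((1 - d / 2) * ln p%:R) = (1 - d / 2) * (2 / k%:R * ln (p%:R : R)).
  by rewrite mulrCA.
rewrite lef_pV2 ?posrE ?sqrtr_gt0 ?expR_gt0//.
exact: ler_wsqrtr.
Qed.

(** This is C p^(- d / 2) + exp (- c p^(d / 2)): the union bound at the outer radius, and the
    probability that all p statistics miss the inner cap. *)
Definition deviation_bound (d C c : R) (p : nat) : R :=
  C * expR (- (d / 2 * ln p%:R)) + expR (- (c * expR (d / 2 * ln p%:R))).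

Lemma deviation_bound_cvg0 (d C c : R) : 0 < d -> 0 < c ->
  deviation_bound d C c p @[p --> \oo] --> (0 : R).
Proof.
move=> d0 c0.
have cvgMry (M : R) (f : nat -> R) : 0 < M ->
    f p @[p --> \oo] --> +oo -> (M * f p) @[p --> \oo] --> +oo.
  move=> M0 /cvgryPge fy; apply/cvgryPge => A.
  by apply: filterS (fy (A / M)) => x; rewrite ler_pdivrMr// mulrC.
have l : (ln p%:R : R) @[p --> \oo] --> +oo.
  apply/cvgryPge => A; near=> p.
  have Ap : expR A <= p%:R by near: p; exact: nbhs_infty_ger.
  by rewrite -[A]expRK ler_ln ?posrE ?expR_gt0// (lt_le_trans _ Ap)// expR_gt0.
have l2 : (d / 2 * ln p%:R : R) @[p --> \oo] --> +oo.
  have d2 : 0 < d / 2 by rewrite divr_gt0.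
  exact: cvgMry d2 l.
have l3 : (c * expR (d / 2 * ln p%:R) : R) @[p --> \oo] --> +oo.
  apply: (cvgMry _ _ c0); apply: ger_cvgy l2; near=> p.
  by apply: le_trans (expR_ge1Dx _); rewrite lerDr.
rewrite (_ : 0 = C * 0 + 0); last by rewrite mulr0 addr0.
apply: cvgD; first apply: cvgM; first exact: cvg_cst.
  exact: (cvg_comp _ _ l2 (@cvgr_expR R)).
exact: (cvg_comp _ _ l3 (@cvgr_expR R)).
Unshelve. all: by end_near.
Qed.

(** B is chosen before k, which is the uniformity in the dimension. The numbers q and g detach the
    estimate from caps, so that inner products and correlations share it; g <= 1, inherited from a
    probability, keeps 1 - g nonnegative. *)
Lemma cap_deviation (d : R) : 0 < d < 1 -> exists2 B : nat -> R,
  B p @[p --> \oo] --> (0 : R) &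
  forall (k p : nat) (t1 t2 : R), (0 < k)%N -> (0 < p)%N ->
  t1 ^+ 2 = (1 + d) * (1 - p%:R `^ (- (2 / k%:R))) ->
  t2 ^+ 2 = (1 - d) * (1 - p%:R `^ (- (2 / k%:R))) ->
  exists q g : R, [/\ 0 <= q, (gauss k.+1 (cap k t1) <= q%:E)%E,
    0 <= g <= 1, (g%:E <= gauss k.+1 (cap k t2))%E & p%:R * q + (1 - g) ^+ p <= B p].
Proof.
move=> d01; have /andP[d0 d1] := d01.
have [C C0 hC] := cap_radius_gt d01; have [c c0 hc] := cap_radius_lt d01.
exists (deviation_bound d C c); first exact: deviation_bound_cvg0.
move=> k p t1 t2 k0 p0 t1E t2E.
exists (C * expR (- ((1 + d / 2) * ln p%:R))), (c * expR (- ((1 - d / 2) * ln p%:R))).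
have p0' : 0 < (p%:R : R) by rewrite ltr0n.
have pE : (p%:R : R) = expR (ln p%:R) by rewrite lnK// posrE.
have hg := hc k p t2 k0 p0 t2E.
have g0 : 0 <= c * expR (- ((1 - d / 2) * ln p%:R)) by rewrite mulr_ge0 ?expR_ge0 ?(ltW c0).
have g1 : c * expR (- ((1 - d / 2) * ln p%:R)) <= 1.
  by rewrite -lee_fin (le_trans hg)// probability_le1//; exact: measurable_cap.
split => //.
- by rewrite mulr_ge0 ?expR_ge0 ?(ltW C0).
- exact: hC.
- by rewrite g0.
rewrite /deviation_bound; apply: lerD.
  rewrite mulrCA {1}pE -expRD ler_wpM2l ?(ltW C0)// ler_expR.
  by rewrite le_eqVlt; apply/orP; left; apply/eqP; field.
apply: (@le_trans _ _ (expR (- (c * expR (- ((1 - d / 2) * ln p%:R)))) ^+ p)).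
  by rewrite lerXn2r ?nnegrE ?subr_ge0 ?expR_ge0// expR_ge1Dx.
rewrite -expRM_natl ler_expR mulrN lerN2 mulrCA ler_wpM2l ?(ltW c0)//.
rewrite [X in _ <= X * _]pE -expRD ler_expR.
by rewrite le_eqVlt; apply/orP; left; apply/eqP; field.
Qed.

(** A bound that ignores n passes to the supremum over n. Only p > 1 is asked for: at p = 1 the
    normalization vanishes, and the limit does not see this value. *)
Lemma unif_vanish_le (n0 : nat) (q : nat -> nat -> \bar R) (B : nat -> R) :
  B p @[p --> \oo] --> (0 : R) ->
  (forall n p, (n0 <= n)%N -> (1 < p)%N -> (0 <= q n p <= (B p)%:E)%E) ->
  unif_vanish n0 q.
Proof.
move=> B0 hq; rewrite /unif_vanish.
have BE : (B p)%:E @[p --> \oo] --> 0%E by apply: cvg_EFin; [exact: nearW|].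
apply: (squeeze_cvge _ (cvg_cst 0%E) BE); near=> p.
have p2 : (1 < p)%N by near: p; exact: nbhs_infty_gt.
apply/andP; split.
  (* The member n = n0 makes the supremum nonnegative; over an empty set it would be -oo. *)
  apply: (@le_trans _ _ (q n0 p)); first by have /andP[] := hq n0 p (leqnn _) p2.
  by apply: ereal_sup_ubound; exists n0 => //=.
apply: ge_ereal_sup => _ [n n0n <-].
by have /andP[] := hq n p n0n p2.
Unshelve. all: by end_near.
Qed.

(** For r >= 0 one has |r - 1| <= |r^2 - 1|, so a deviation of either ratio pushes M^2 out of the
    interval from (1 - d) v to (1 + d) v. *)
Lemma ratio_deviation (M v e d : R) : 0 <= M -> 0 < v -> 0 < d -> d <= e -> d < 1 ->
  e < `|M / Num.sqrt v - 1| \/ e < `|M ^+ 2 / v - 1| ->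
  Num.sqrt ((1 + d) * v) < M \/ M < Num.sqrt ((1 - d) * v).
Proof.
move=> M0 v0 d0 de d1 h.
have [h1|h1] := ltP (Num.sqrt ((1 + d) * v)) M; first by left.
right; rewrite ltNge; apply/negP => h2.
have s0 : 0 < Num.sqrt v by rewrite sqrtr_gt0.
have u0 : 0 <= (1 + d) * v by rewrite mulr_ge0 ?addr_ge0 ?ltW.
have l0 : 0 <= (1 - d) * v by rewrite mulr_ge0 ?subr_ge0 ?ltW.
have M1 : M ^+ 2 <= (1 + d) * v.
  by rewrite -[leRHS]sqr_sqrtr// lerXn2r// nnegrE sqrtr_ge0.
have M2 : (1 - d) * v <= M ^+ 2.
  by rewrite -[leLHS]sqr_sqrtr// lerXn2r// nnegrE sqrtr_ge0.
have rE : (M / Num.sqrt v) ^+ 2 = M ^+ 2 / v by rewrite expr_div_n sqr_sqrtr// ltW.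
have r1 : M ^+ 2 / v <= 1 + d by rewrite ler_pdivrMr.
have r2 : 1 - d <= M ^+ 2 / v by rewrite ler_pdivlMr.
have r0 : 0 <= M / Num.sqrt v by rewrite divr_ge0// ltW.
case: h; apply/negP; rewrite -leNgt ler_norml; apply/andP; split; try lra.
- by move: rE r0; set r := M / Num.sqrt v; move=> rE r0; nra.
- by move: rE r0; set r := M / Num.sqrt v; move=> rE r0; nra.
Qed.

End cap_radius.

(** * Independence and conditioning *)

Lemma mutual_indepT {R : realType} d d1 (T : measurableType d) (T1 : measurableType d1)
    (P : probability T R) (I : finType) (X : I -> T -> T1) (A : I -> set T1) :
  mutual_indep P X -> (forall i, measurable (A i)) ->
  P [set w | forall i, A i (X i w)] = (\prod_i P (X i @^-1` A i))%E.
Proof.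
move=> hX mA; transitivity (\prod_(i in [set: I]%SET) P (X i @^-1` A i))%E; last first.
  by apply: eq_bigl => i; rewrite inE.
rewrite -hX//; congr (P _); apply/seteqP; split => w /= h i; first by move=> _; exact: h.
by apply: h; rewrite /= inE.
Qed.

Section joint_law.
Context {R : realType} {d d1 d2 : measure_display}.
Context {T : measurableType d} {T1 : measurableType d1} {T2 : measurableType d2}.
Variables (P : probability T R) (p : nat) (mu : 'I_p -> probability T1 R).
Variables (nu : probability T2 R) (V : T -> p.-tuple T1) (W : T -> T2).
Hypotheses (mV : measurable_fun setT V) (mW : measurable_fun setT W).
Hypothesis VW : forall C D, measurable C -> measurable D ->
  (P (V @^-1` C `&` W @^-1` D) = tuple_prod mu C * nu D)%E.
Local Open Scope ereal_scope.

Let f w := (W w, V w).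

Let mf : measurable_fun setT f. Proof. exact: measurable_fun_pair. Qed.

Lemma joint_law (X : set (T2 * p.-tuple T1)) : measurable X ->
  P [set w | X (W w, V w)] = (nu \x tuple_prod mu) X.
Proof.
move=> mX; pose m : {measure set _ -> \bar R} := pushforward P f.
rewrite (product_measure_unique (m' := m mf))// => A B mA mB.
rewrite muleC -VW// /m /pushforward; congr (P _).
by apply/seteqP; split => w /= [].
Qed.

Lemma joint_law_measurable (X : set (T2 * p.-tuple T1)) : measurable X ->
  measurable [set w | X (W w, V w)].
Proof. by move=> mX; rewrite -[X in measurable X]setTI; exact: mf. Qed.

Variables (S1 S2 : set (T2 * T1)) (D : set T2) (q g : R).
Hypotheses (mS1 : measurable S1) (mS2 : measurable S2) (mD : measurable D).
Hypotheses (q0 : (0 <= q)%R) (g01 : (0 <= g <= 1)%R).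
Hypothesis hq : forall w j, D w -> mu j (xsection S1 w) <= q%:E.
Hypothesis hg : forall w j, D w -> g%:E <= mu j (xsection S2 w).

Lemma joint_exists_measurable :
  measurable [set w | D (W w) /\ exists j, S1 (W w, tnth (V w) j)].
Proof.
have m1 : measurable [set wv : T2 * p.-tuple T1 | D wv.1 /\ exists j, S1 (wv.1, tnth wv.2 j)].
  exact: measurable_exists_section.
exact: (joint_law_measurable m1).
Qed.

Lemma joint_forall_measurable :
  measurable [set w | D (W w) /\ forall j, ~ S2 (W w, tnth (V w) j)].
Proof.
have m2 : measurable [set wv : T2 * p.-tuple T1 | D wv.1 /\ forall j, ~ S2 (wv.1, tnth wv.2 j)].
  exact: measurable_forall_section.
exact: (joint_law_measurable m2).
Qed.

Lemma joint_exists_le :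
  P [set w | D (W w) /\ exists j, S1 (W w, tnth (V w) j)] <= (p%:R * q)%:E * nu D.
Proof.
have := product_exists_section_le nu mS1 mD q0 hq.
by rewrite -joint_law//; exact: measurable_exists_section.
Qed.

(** With [S1] and [S2] the events that one statistic exceeds the outer and the inner radius, the two
    sets cover the upward and the downward deviation of the maximum. *)
Lemma joint_deviation_le :
  P ([set w | D (W w) /\ exists j, S1 (W w, tnth (V w) j)] `|`
     [set w | D (W w) /\ forall j, ~ S2 (W w, tnth (V w) j)])
  <= (p%:R * q + (1 - g) ^+ p)%:E * nu D.
Proof.
have m2 : measurable [set wv : T2 * p.-tuple T1 | D wv.1 /\ forall j, ~ S2 (wv.1, tnth wv.2 j)].
  exact: measurable_forall_section.
apply: le_trans (measureU2 _ joint_exists_measurable joint_forall_measurable) _.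
rewrite EFinD ge0_muleDl ?lee_fin ?mulr_ge0 ?exprn_ge0 ?subr_ge0//; last first.
  by have /andP[] := g01.
apply: leeD; first exact: joint_exists_le.
have := product_forall_section_le nu mS2 mD g01 hg.
by rewrite -joint_law.
Qed.

End joint_law.

Lemma mutual_indep_tuple_prod {R : realType} d d1 (T : measurableType d)
  (T1 : measurableType d1) (P : probability T R) p (X : 'I_p -> {RV P >-> T1}) :
  mutual_indep P (fun j => X j : T -> T1) ->
  forall C, measurable C ->
  P ((fun w => [tuple X j w | j < p]) @^-1` C) =
  tuple_prod (fun j => distribution P (X j)) C.
Proof.
move=> hX C mC.
have mV : measurable_fun setT (fun w => [tuple X j w | j < p]) by exact: measurable_mktuple.
pose m : {measure set _ -> \bar R} := pushforward P (fun w => [tuple X j w | j < p]).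
apply: (tuple_measure_unique (G := measurable) (m1 := m mV)) => //.
- by rewrite sigma_algebra_id//; exact: sigma_algebra_measurable.
- exact: measurableI.
- by rewrite (_ : m mV setT = P setT)// probability_setT ltry.
- move=> A mA; apply: etrans (esym (tuple_prod_box _ mA)).
  rewrite -(mutual_indepT hX mA); congr (P _); apply/seteqP; split => w /= h i.
    by have := h i; rewrite tnth_mktuple.
  by rewrite tnth_mktuple; exact: h.
Qed.

(** * Reflections exchanging two unit vectors *)

Section uniform_sphere.
Context {R : realType}.

Lemma probability1_setI d (T : measurableType d) (P : probability T R) (A D : set T) :
  measurable A -> measurable D -> P D = 1%E -> P (A `&` D) = P A.
Proof.
move=> mA mD D1; rewrite [RHS](measureDI _ mA mD).
rewrite [X in (X + _)%E](_ : _ = 0%E) ?add0e//.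
apply/eqP; rewrite eq_le measure_ge0 andbT.
have <- : P (~` D) = 0%E by rewrite probability_setC// D1 subee.
apply: le_measure; rewrite ?inE//.
- exact: measurableD.
- exact: measurableC.
Qed.

Lemma innerC n (x y : n.-tuple R) : inner x y = inner y x.
Proof. by apply: eq_bigr => i _; rewrite mulrC. Qed.

(* Q is the Householder reflection that swaps u and w. *)
Lemma reflection_exchange n (u w : n.-tuple R) : inner u u = 1 -> inner w w = 1 ->
  exists2 Q : 'M[R]_n, Q *m Q^T = 1%:M & forall x, inner (mx_act Q x) u = inner x w.
Proof.
move=> u1 w1; have [->|uw] := eqVneq u w.
  exists 1%:M; first by rewrite trmx1 mulmx1.
  move=> x; congr inner; apply: eq_from_tnth => i; rewrite tnth_mktuple.
  rewrite (bigD1 i)//= mxE eqxx mul1r big1 ?addr0// => j ji.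
  by rewrite mxE eq_sym (negbTE ji) mul0r.
(* With N the squared norm of v, Q is I - (2 / N) v v^T. Unit norms give N = 2 (1 - c) and <v, u> =
   N / 2, whence <Q x, u> = <x, u> - <x, v> = <x, w>. *)
pose v i := tnth u i - tnth w i.
pose N := \sum_i v i * v i.
pose c := inner u w.
have NE : N = 2 * (1 - c).
  rewrite /N /v.
  rewrite (eq_bigr (fun i =>
    tnth u i * tnth u i + tnth w i * tnth w i - 2 * (tnth u i * tnth w i))).
    rewrite sumrB big_split/= -mulr_sumr -/(inner u u) -/(inner w w) -/(inner u w) u1 w1 -/c.
    by ring.
  by move=> i _; ring.
have N0 : N != 0.
  apply: contra uw => /eqP N0; apply/eqP/eq_from_tnth => i.
  have : \sum_i v i * v i == 0 by rewrite -/N N0.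
  rewrite psumr_eq0; last by move=> j _; rewrite -expr2 sqr_ge0.
  by move=> /allP/(_ i (mem_index_enum _)); rewrite -expr2 sqrf_eq0 subr_eq0 => /eqP.
pose Q : 'M[R]_n := \matrix_(i, k) ((i == k)%:R - 2 / N * v i * v k).
have sum_delta i (f : 'I_n -> R) : \sum_k (i == k)%:R * f k = f i.
  rewrite (bigD1 i)//= eqxx mul1r big1 ?addr0// => k ki.
  by rewrite eq_sym (negbTE ki) mul0r.
exists Q.
  apply/matrixP => i j; rewrite !mxE.
  rewrite (eq_bigr (fun k => (i == k)%:R * ((j == k)%:R - 2 / N * v j * v k)
    - 2 / N * v i * ((j == k)%:R * v k) + (2 / N) ^+ 2 * v i * v j * (v k * v k))); last first.
    by move=> k _; rewrite !mxE; ring.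
  rewrite big_split/= sumrB -!mulr_sumr !sum_delta -/N eq_sym.
  by field.
move=> x; pose a := \sum_k v k * tnth x k.
have Qx i : tnth (mx_act Q x) i = tnth x i - 2 / N * a * v i.
  rewrite tnth_mktuple (eq_bigr (fun k =>
    (i == k)%:R * tnth x k - 2 / N * v i * (v k * tnth x k))).
    by rewrite sumrB sum_delta -mulr_sumr -/a; ring.
  by move=> k _; rewrite !mxE; ring.
rewrite /inner (eq_bigr (fun i =>
  tnth x i * tnth u i - 2 / N * a * (v i * tnth u i))); last first.
  by move=> i _; rewrite Qx; ring.
rewrite sumrB -mulr_sumr.
have -> : \sum_i v i * tnth u i = N / 2.
  rewrite NE /v (eq_bigr (fun i => tnth u i * tnth u i - tnth u i * tnth w i)).
    by rewrite sumrB -/(inner u u) -/(inner u w) u1 -/c; field.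
  by move=> i _; ring.
have -> : 2 / N * a * (N / 2) = a by field.
rewrite -sumrB; transitivity (\sum_i tnth x i * tnth u i - a); first by rewrite sumrB.
rewrite -sumrB; apply: eq_bigr => i _; rewrite /v; ring.
Qed.

End uniform_sphere.

(** * The uniform distribution on the sphere *)

Lemma lt_normr_sqr {R : realType} (t x : R) : 0 <= t -> (t < `|x|) = (t ^+ 2 < x ^+ 2).
Proof. by move=> t0; rewrite -[(x ^+ 2)]real_normK ?num_real// ltr_pXn2r// nnegrE. Qed.

Section sphere_cap.
Context {R : realType}.
Local Open Scope ereal_scope.

Lemma sphereE n (x : n.-tuple R) : sphere x <-> inner x x = 1%R.
Proof.
rewrite /sphere/=; split => [h|->]; last by rewrite sqrtr1.
by rewrite -[LHS]sqr_sqrtr ?inner_ge0// h expr1n.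
Qed.

Lemma measurable_sphere n : measurable (sphere : set (n.-tuple R)).
Proof.
rewrite (_ : sphere = [set x | inner x x = 1%R]).
  by apply: measurable_eqr_set; exact: measurable_inner.
by apply/seteqP; split => x /sphereE.
Qed.

Lemma innerZr n (x y : n.-tuple R) (a : R) :
  inner x [tuple (tnth y i * a)%R | i < n] = (inner x y * a)%R.
Proof.
rewrite /inner mulr_suml; apply: eq_bigr => i _.
by rewrite tnth_mktuple mulrA.
Qed.

Lemma measurable_inner_gt n (t : R) (u : n.-tuple R) :
  measurable [set x : n.-tuple R | t < `|inner x u|]%R.
Proof.
apply: measurable_ltr_set => //; apply: measurableT_comp => //.
exact: measurable_inner.
Qed.

Lemma uniform_sphere_rotate n (mu : probability (n.-tuple R) R) (t : R) (u w : n.-tuple R) :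
  uniform_on_sphere mu -> inner u u = 1%R -> inner w w = 1%R ->
  mu [set x | t < `|inner x u|]%R = mu [set x | t < `|inner x w|]%R.
Proof.
move=> [_ hmu] u1 w1; have [Q QQ hQ] := reflection_exchange u1 w1.
rewrite -(hmu Q QQ); last exact: measurable_inner_gt.
by congr (mu _); apply/seteqP; split => x /=; rewrite hQ.
Qed.

Lemma inner_eq0 n (z : n.-tuple R) : inner z z = 0%R -> forall x, inner x z = 0%R.
Proof.
move=> /eqP; rewrite psumr_eq0; last by move=> i _; rewrite -expr2 sqr_ge0.
move=> /allP h x; rewrite /inner big1// => i _.
have := h i (mem_index_enum _); rewrite -expr2 sqrf_eq0 => /eqP ->.
by rewrite mulr0.
Qed.

Lemma uniform_sphere_cap k (mu : probability (k.+1.-tuple R) R) (t : R) (u : k.+1.-tuple R) :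
  uniform_on_sphere mu -> (0 <= t)%R -> inner u u = 1%R ->
  mu [set x | t < `|inner x u|]%R = gauss k.+1 (cap k t).
Proof.
move=> umu t0 u1; have [mu1 _] := umu.
(* The condition on x makes every nonempty x-section a rotated cap; the complement of the sphere is
   null for mu. *)
pose E := [set xz : k.+1.-tuple R * k.+1.-tuple R |
  sphere xz.1 /\ (t ^+ 2 * inner xz.2 xz.2 < inner xz.1 xz.2 ^+ 2)%R].
have mE : measurable E.
  apply: measurableI.
    by rewrite -[X in measurable X]setTI; apply: measurable_fst => //; exact: measurable_sphere.
  apply: measurable_ltr_set.
    by apply: measurable_funM => //; exact: measurable_inner.
  by apply: measurable_funX; exact: measurable_inner.
have -> : gauss k.+1 (cap k t) = (mu \x gauss k.+1) E.
  rewrite /product_measure1 (eq_integral ((cst (gauss k.+1 (cap k t))) \_ sphere)).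
    rewrite -integral_mkcond integral_cst//; last exact: measurable_sphere.
    by rewrite -[LHS]mule1; congr (_ * _); exact/esym.
  move=> x _; rewrite patchE; case: ifPn => [/set_mem|/negP] sx.
    rewrite /comp /cst -(@gauss_cap_rotate _ _ t x); last exact/sphereE.
    congr (gauss _ _); apply/seteqP; split => z; rewrite /xsection/= inE /E/=.
      by move=> [].
    by move=> h; split.
  rewrite /comp (_ : xsection E x = set0) ?measure0// -subset0 => z.
  by rewrite /xsection/= inE /E/= => -[s _]; apply: sx; exact: mem_set.
rewrite (@product_measure_unique _ _ _ _ _ _ _ (mu \x^ gauss k.+1))//; last first.
  by move=> A B mA mB; exact: product_measure2E.
(* The vector z = 0 cannot be normalized to a unit vector; it is a Gaussian null set, and its
   section of E is empty. *)
set G := mu _; pose Z := [set z : k.+1.-tuple R | inner z z = 0%R].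
have mZ : measurable Z by apply: measurable_eqr_set; exact: measurable_inner.
have <- : G * gauss k.+1 (~` Z) = G.
  by rewrite probability_setC// /Z gauss_inner_eq0 sube0 mule1.
rewrite /product_measure2 -integral_cst//; last exact: measurableC.
rewrite integral_mkcond; apply: eq_integral => z _.
rewrite patchE; case: ifPn => [/set_mem|/negP] zZ; last first.
  rewrite /comp (_ : ysection E z = set0) ?measure0// -subset0 => x.
  rewrite /ysection/= inE /E/= => -[_].
  have z0 : inner z z = 0%R by apply: contrapT => ?; apply: zZ; exact: mem_set.
  by rewrite z0 (inner_eq0 z0) mulr0 expr0n ltxx.
have z0 : (0 < inner z z)%R by rewrite lt_neqAle inner_ge0 andbT eq_sym; exact/eqP.
pose w := [tuple (tnth z i * (Num.sqrt (inner z z))^-1)%R | i < k.+1].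
have w1 : inner w w = 1%R.
  rewrite innerZr innerC innerZr -mulrA -expr2 exprVn sqr_sqrtr ?inner_ge0//.
  by rewrite divff// gt_eqF.
rewrite /comp /cst /G (uniform_sphere_rotate t umu u1 w1).
rewrite -(probability1_setI (measurable_inner_gt t w) (@measurable_sphere k.+1) mu1).
congr (mu _); apply/seteqP; split => x; rewrite /ysection/= inE /E/=.
  move=> [h sx]; split => //; move: h.
  by rewrite innerZr lt_normr_sqr// exprMn exprVn sqr_sqrtr ?inner_ge0// ltr_pdivlMr.
move=> [sx h]; split => //; move: h.
by rewrite innerZr lt_normr_sqr// exprMn exprVn sqr_sqrtr ?inner_ge0// ltr_pdivlMr.
Qed.

End sphere_cap.

(** * Maximal inner product *)

Section maxima.
Context {R : realType} (p : nat) (F : 'I_p -> R).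

Lemma bigmax0_ge0 : 0 <= \big[Num.max/0]_(j < p) F j.
Proof. exact: bigmax_ge_id. Qed.

Lemma bigmax0_gt (t : R) : 0 <= t -> t < \big[Num.max/0]_(j < p) F j ->
  exists j, t < F j.
Proof.
move=> t0 tM; apply: contrapT => h; move: tM; apply/negP; rewrite -leNgt.
apply: bigmax_le => // j _; rewrite leNgt; apply/negP => tF; apply: h.
by exists j.
Qed.

Lemma bigmax0_lt (t : R) : \big[Num.max/0]_(j < p) F j < t ->
  forall j, ~ t < F j.
Proof.
move=> tM j; apply/negP; rewrite -leNgt; apply: le_trans (ltW tM).
exact: le_bigmax.
Qed.

End maxima.

Lemma sphere_radius_gt0 {R : realType} (k p : nat) : (0 < k)%N -> (1 < p)%N ->
  0 < 1 - p%:R `^ (- (2 / k%:R)) :> R.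
Proof.
move=> k0 p1; rewrite powR_sphere ?(ltnW p1)// subr_gt0 -[ltRHS]expR0 ltr_expR oppr_lt0.
by rewrite mulr_gt0 ?divr_gt0 ?ltr0n// ln_gt0// ltr1n.
Qed.

Lemma shrink_deviation {R : realType} (e : R) : 0 < e -> exists2 d : R, 0 < d < 1 & d <= e.
Proof. by move=> e0; have [h|h] := leP e 2^-1; [exists e|exists 2^-1]; lra. Qed.

(** B precedes the probability space, so one bound serves all n at once. The abstract event A treats
    deviations of M and of M^2 together. *)
Lemma max_inner_deviation {R : realType} (e : R) : 0 < e -> exists2 B : nat -> R,
  B p @[p --> \oo] --> (0 : R) &
  forall d (T : measurableType d) (P : probability T R) (n p : nat)
    (L : 'I_p -> {RV P >-> n.-tuple R}) (U : {RV P >-> n.-tuple R}) (A : set T),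
  (2 <= n)%N -> (1 < p)%N -> mutual_indep P (fun j => L j : T -> n.-tuple R) ->
  (forall j, uniform_on_sphere (distribution P (L j))) ->
  distribution P U sphere = 1%E ->
  indep P (fun w => [tuple L j w | j < p]) U ->
  measurable A ->
  (forall w, A w -> let M := max_inner (L ^~ w) (U w) in
    e < `|M / saber n p - 1| \/ e < `|M ^+ 2 / (1 - p%:R `^ (- (2 / (n%:R - 1)))) - 1|) ->
  (P A <= (B p)%:E)%E.
Proof.
move=> e0; have [d d01 de] := shrink_deviation e0; have /andP[d0 d1] := d01.
have [B B0 hB] := cap_deviation d01; exists B => // dT T P [//|n] p L U A.
rewrite ltnS => n0 p1 iL uL sU iLU mA hA.
have nE : n.+1%:R - 1 = n%:R :> R by rewrite -natr1 addrK.
have v0 := @sphere_radius_gt0 R n p n0 p1.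
set v : R := 1 - _ in v0.
have t1E : Num.sqrt ((1 + d) * v) ^+ 2 = (1 + d) * v.
  by rewrite sqr_sqrtr// mulr_ge0 ?(ltW v0)// addr_ge0// ltW.
have t2E : Num.sqrt ((1 - d) * v) ^+ 2 = (1 - d) * v.
  by rewrite sqr_sqrtr// mulr_ge0 ?(ltW v0)// subr_ge0 ltW.
have [q [g [q0 hq g01 hg qgB]]] := hB n p _ _ n0 (ltnW p1) t1E t2E.
pose V w := [tuple L j w | j < p].
have mV : measurable_fun setT V by exact: measurable_mktuple.
pose S (t : R) := [set ux : n.+1.-tuple R * n.+1.-tuple R | t < `|inner ux.2 ux.1|].
have mS t : measurable (S t).
  apply: measurable_ltr_set => //; apply: measurableT_comp => //.
  exact: measurable_inner.
have SE (t : R) u j : 0 <= t -> sphere u ->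
    distribution P (L j) (xsection (S t) u) = gauss n.+1 (cap n t).
  move=> t0 /sphereE u1; rewrite -(uniform_sphere_cap (uL j) t0 u1).
  by congr (distribution _ _ _); apply/seteqP; split => x; rewrite /xsection/= inE.
have VW C D : measurable C -> measurable D ->
    (P (V @^-1` C `&` U @^-1` D) =
     tuple_prod (fun j => distribution P (L j)) C * distribution P U D)%E.
  by move=> mC mD; rewrite iLU// mutual_indep_tuple_prod.
have h1 u j : sphere u ->
    (distribution P (L j) (xsection (S (Num.sqrt ((1 + d) * v))) u) <= q%:E)%E.
  by move=> su; rewrite SE// sqrtr_ge0.
have h2 u j : sphere u ->
    (g%:E <= distribution P (L j) (xsection (S (Num.sqrt ((1 - d) * v))) u))%E.
  by move=> su; rewrite SE// sqrtr_ge0.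
have mU : measurable_fun setT U by [].
have := joint_deviation_le mV mU VW (mS _) (mS _) (@measurable_sphere R n.+1) q0 g01 h1 h2.
have sU' : (distribution P U : probability _ _) sphere = 1%E := sU.
rewrite sU' mule1 => hP.
have mUs : measurable (U @^-1` sphere).
  by rewrite -[X in measurable X]setTI; apply: mU => //; exact: measurable_sphere.
(* [U] is on the sphere only almost surely, so A is cut down to that event. *)
rewrite -(probability1_setI mA mUs sU).
apply: le_trans (le_trans hP _); last by rewrite lee_fin.
apply: le_measure; rewrite ?inE//.
- exact: measurableI.
- apply: measurableU.
    exact: (joint_exists_measurable mV mU (mS _) (@measurable_sphere R n.+1)).
  exact: (joint_forall_measurable mV mU (mS _) (@measurable_sphere R n.+1)).
move=> w [Aw sw].
have M0 : 0 <= max_inner (L ^~ w) (U w) := bigmax0_ge0 _.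
have := hA w Aw; rewrite /saber nE -/v /= => hw.
have [h|h] := ratio_deviation M0 v0 d0 de d1 hw.
  left; split => //; have [//|j hj] := bigmax0_gt _ h.
  by exists j; rewrite /S/= tnth_mktuple.
right; split => // j; rewrite /S/= tnth_mktuple.
exact: (bigmax0_lt (F := fun j => `|inner (L j w) (U w)|) h).
Qed.

Lemma saber_sharp (R : realType) (d : nat -> nat -> measure_display)
    (T : forall n p : nat, measurableType (d n p))
    (P : forall n p : nat, probability (T n p) R)
    (L : forall n p : nat, 'I_p -> {RV (P n p) >-> n.-tuple R})
    (U : forall n p : nat, {RV (P n p) >-> n.-tuple R}) :
  (forall n p : nat, (2 <= n)%N -> (0 < p)%N ->
    [/\ mutual_indep (P n p) (fun j : 'I_p => L n p j : T n p -> n.-tuple R),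
        forall j : 'I_p, uniform_on_sphere (distribution (P n p) (L n p j)),
        distribution (P n p) (U n p) sphere = 1%E
      & indep (P n p) (fun w => [tuple L n p j w | j < p]) (U n p)]) ->
  let M n p w : R := max_inner (fun j : 'I_p => L n p j w) (U n p w) in
  forall delta : R, 0 < delta ->
    unif_vanish 2 (fun n p => P n p [set w | delta < `|M n p w / saber n p - 1|])
    /\
    unif_vanish 2 (fun n p => P n p [set w | delta <
        `|M n p w ^+ 2 / (1 - p%:R `^ (- (2 / (n%:R - 1)))) - 1|]).
Proof.
move=> hyp M delta delta0.
have [B B0 hB] := max_inner_deviation delta0.
have mM n p : measurable_fun setT (M n p).
  apply: measurable_bigmax0 => j; apply: measurableT_comp => //.
  exact: measurable_inner.
split; apply: (unif_vanish_le B0) => n p n2 p1; rewrite measure_ge0/=;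
  have [iL uL sU iLU] := hyp n p n2 (ltnW p1); apply: (hB _ _ _ _ _ _ _ _ n2 p1 iL uL sU iLU).
- exact: measurable_deviation.
- by move=> w /= ?; left.
- by apply: measurable_deviation; exact: measurable_funX.
- by move=> w /= ?; right.
Qed.

(** * Product rules on generating classes *)

Section pi_independence.
Context {R : realType} {d d1 d2 : measure_display}.
Context {T : measurableType d} {T1 : measurableType d1} {T2 : measurableType d2}.
Variable P : probability T R.
Local Open Scope ereal_scope.

(** Both sides are finite measures in C that agree on a generating pi-system; finiteness of c makes
    the right one a rescaling of mu. *)
Lemma product_rule_extend d' (T' : measurableType d') (V : T -> T') (E : set T)
    (mu : probability T' R) (c : \bar R) (G : set (set T')) :
  measurable_fun setT V -> measurable E -> 0 <= c -> c < +oo ->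
  @measurable _ T' = <<s G >> -> setI_closed G -> G setT ->
  (forall C, G C -> P (V @^-1` C `&` E) = mu C * c) ->
  forall C, measurable C -> P (V @^-1` C `&` E) = mu C * c.
Proof.
move=> mV mE c0 coo GE GI GT h C mC.
have cE : c = (fine c)%:E by rewrite fineK// ge0_fin_numE.
have fc0 : (0 <= fine c)%R by exact: fine_ge0.
pose m1 : {measure set T' -> \bar R} := pushforward (mrestr P mE) V.
pose m2 : {measure set T' -> \bar R} := mscale (NngNum fc0) mu.
have m2E A : m2 A = mu A * c by rewrite [c in RHS]cE muleC.
rewrite -m2E.
apply: (measure_unique G (fun=> setT) GE GI _ _ (m1 mV) m2) => //.
- by apply/seteqP; split => // x _; exists 0%N.
- by move=> A GA; rewrite m2E; exact: h.
- move=> _; have -> : m1 mV setT = mu setT * c by exact: h.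
  by rewrite probability_setT mul1e.
Qed.

(** The two classes are extended one after the other, with the other event held fixed. *)
Lemma product_rule_generated (V : T -> T1) (W : T -> T2)
    (mu : probability T1 R) (nu : probability T2 R)
    (G1 : set (set T1)) (G2 : set (set T2)) :
  measurable_fun setT V -> measurable_fun setT W ->
  @measurable _ T1 = <<s G1 >> -> setI_closed G1 -> G1 setT ->
  @measurable _ T2 = <<s G2 >> -> setI_closed G2 -> G2 setT ->
  (forall C D, G1 C -> G2 D -> P (V @^-1` C `&` W @^-1` D) = mu C * nu D) ->
  forall C D, measurable C -> measurable D ->
    P (V @^-1` C `&` W @^-1` D) = mu C * nu D.
Proof.
move=> mV mW E1 I1 T1' E2 I2 T2' h C D mC mD.
have fin d' (T' : measurableType d') (m : probability T' R) (A : set T') :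
    measurable A -> m A < +oo.
  by move=> mA; rewrite (le_lt_trans (probability_le1 m mA))// ltry.
have mG2 D' : G2 D' -> measurable D' by rewrite E2; exact: sub_sigma_algebra.
have mWD D' : measurable D' -> measurable (W @^-1` D').
  by move=> mD'; rewrite -[X in measurable X]setTI; exact: mW.
have mVC : measurable (V @^-1` C).
  by rewrite -[X in measurable X]setTI; exact: mV.
rewrite setIC muleC.
apply: (product_rule_extend mW mVC _ _ E2 I2 T2') => //; first exact: fin.
move=> D' GD'; rewrite setIC muleC.
apply: (product_rule_extend mV (mWD _ (mG2 _ GD')) _ _ E1 I1 T1') => //.
  exact/fin/mG2.
by move=> C' GC'; exact: h.
Qed.

End pi_independence.

(** * Sample correlations *)

Section correlation_algebra.
Context {R : realType} {n : nat}.
Implicit Types x y : 'I_n.+1 -> R.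

Lemma sum_dev0 x : \sum_i (x i - sample_mean x) = 0.
Proof.
rewrite sumrB sumr_const card_ord /sample_mean -[X in _ - X]mulr_natr divfK ?subrr//.
Qed.

Lemma sample_covE x y :
  \sum_i (x i - sample_mean x) * (y i - sample_mean y) =
  \sum_i x i * (y i - sample_mean y).
Proof.
under eq_bigr do rewrite mulrBl.
by rewrite sumrB -mulr_sumr sum_dev0 mulr0 subr0.
Qed.

Lemma sum_sq_devE x :
  sum_sq_dev x = \sum_i x i * x i - (\sum_i x i) ^+ 2 / n.+1%:R.
Proof.
rewrite /sum_sq_dev; under eq_bigr do rewrite expr2.
rewrite sample_covE; under eq_bigr do rewrite mulrBr.
by rewrite sumrB -mulr_suml /sample_mean mulrA.
Qed.

Lemma sum_sq_dev_ge0 x : 0 <= sum_sq_dev x.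
Proof. by apply: sumr_ge0 => i _; rewrite sqr_ge0. Qed.

Lemma sample_mean_affine x (m s : R) :
  sample_mean (fun i => (x i - m) / s) = (sample_mean x - m) / s.
Proof.
rewrite /sample_mean -mulr_suml sumrB sumr_const card_ord -[m *+ _]mulr_natr mulrAC mulrBl.
by rewrite mulfK ?pnatr_eq0.
Qed.

Lemma sample_dev_affine x (m s : R) i :
  (x i - m) / s - sample_mean (fun i => (x i - m) / s) = (x i - sample_mean x) / s.
Proof. by rewrite sample_mean_affine -mulrBl; congr (_ / _); ring. Qed.

Lemma sum_sq_dev_affine x (m s : R) :
  sum_sq_dev (fun i => (x i - m) / s) = sum_sq_dev x / s ^+ 2.
Proof.
rewrite /sum_sq_dev mulr_suml; apply: eq_bigr => i _.
by rewrite sample_dev_affine expr_div_n.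
Qed.

(** This reduces normal observations of any mean and variance to standard ones. *)
Lemma sample_corr_affine x y (m s : R) : 0 < s ->
  sample_corr (fun i => (x i - m) / s) y = sample_corr x y.
Proof.
move=> s0; rewrite /sample_corr sum_sq_dev_affine.
under eq_bigr do rewrite sample_dev_affine mulrAC.
rewrite -mulr_suml sqrtrM ?sum_sq_dev_ge0// -exprVn sqrtr_sqr gtr0_norm ?invr_gt0//.
rewrite [_ / s * Num.sqrt _]mulrAC [X in _ / X]mulrC invfM invrK mulrA.
by rewrite divfK// gt_eqF.
Qed.

(** Clearing the denominators gives an inequality that can be matched with a Gaussian cap. In the
    covariance it is enough to centre y, since its deviations sum to 0. *)
Lemma lt_sample_corr x y (t : R) : 0 <= t -> corr_defined x y ->
  (t < `|sample_corr x y|) =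
  (t ^+ 2 * (sum_sq_dev x * sum_sq_dev y) <
   (\sum_i x i * (y i - sample_mean y)) ^+ 2).
Proof.
move=> t0 [x0 y0]; rewrite lt_normr_sqr// /sample_corr sample_covE.
rewrite expr_div_n exprMn !sqr_sqrtr ?sum_sq_dev_ge0// ltr_pdivlMr//.
by rewrite mulr_gt0// lt_neqAle eq_sym ?x0 ?y0 sum_sq_dev_ge0.
Qed.

End correlation_algebra.

Section measurable_correlation.
Context {R : realType} {d : measure_display} {T : measurableType d} {n : nat}.
Implicit Types f g : 'I_n -> T -> R.

Lemma measurable_sample_mean f : (forall i, measurable_fun setT (f i)) ->
  measurable_fun setT (fun w => sample_mean (f ^~ w)).
Proof. by move=> mf; apply: measurable_funM => //; exact: measurable_sum. Qed.

Lemma measurable_sum_sq_dev f : (forall i, measurable_fun setT (f i)) ->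
  measurable_fun setT (fun w => sum_sq_dev (f ^~ w)).
Proof.
move=> mf; apply: measurable_sum => i; apply: measurable_funX.
by apply: measurable_funB => //; exact: measurable_sample_mean.
Qed.

Lemma measurable_sample_corr f g : (forall i, measurable_fun setT (f i)) ->
  (forall i, measurable_fun setT (g i)) ->
  measurable_fun setT (fun w => sample_corr (f ^~ w) (g ^~ w)).
Proof.
move=> mf mg; apply: measurable_funM.
  apply: measurable_sum => i; apply: measurable_funM;
    apply: measurable_funB => //; exact: measurable_sample_mean.
have sqrtE (x : R) : 0 <= x -> Num.sqrt x = x `^ 2^-1 by move=> ?; rewrite powR12_sqrt.
(* Square root and inverse become real powers; at 0 both conventions give 0. *)
rewrite (_ : (fun w => _) = fun w =>
  (sum_sq_dev (f ^~ w) `^ 2^-1 * sum_sq_dev (g ^~ w) `^ 2^-1) `^ (-1)); last first.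
  apply/funext => w; rewrite powR_inv1 ?mulr_ge0 ?powR_ge0//.
  by rewrite !sqrtE// sumr_ge0// => i _; rewrite sqr_ge0.
have mpow (r : R) (h : T -> R) :
    measurable_fun setT h -> measurable_fun setT (fun w => h w `^ r).
  by move=> mh; apply: (@measurableT_comp _ _ _ T R R (fun x : R => x `^ r) _ h).
by apply: (mpow); apply: measurable_funM; apply: (mpow); exact: measurable_sum_sq_dev.
Qed.

End measurable_correlation.

Section gauss_correlation.
Context {R : realType} {k : nat}.
Notation vec := (k.+2.-tuple R).

(** The first component is the response vector, on which one conditions; the second is one column of
    observations. *)
Definition corr_cap (t : R) : set (vec * vec) :=
  [set yz | t ^+ 2 * (sum_sq_dev (tnth yz.2) * sum_sq_dev (tnth yz.1)) <
     (\sum_i tnth yz.2 i * (tnth yz.1 i - sample_mean (tnth yz.1))) ^+ 2].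

Let measurable_tnth2 (i : 'I_k.+2) : measurable_fun setT (fun yz : vec * vec => tnth yz.2 i).
Proof. exact: measurableT_comp (measurable_tnth i) measurable_snd. Qed.

Let measurable_tnth1 (i : 'I_k.+2) : measurable_fun setT (fun yz : vec * vec => tnth yz.1 i).
Proof. exact: measurableT_comp (measurable_tnth i) measurable_fst. Qed.

Lemma measurable_corr_cap t : measurable (corr_cap t).
Proof.
apply: measurable_ltr_set.
  apply: measurable_funM => //; apply: measurable_funM.
    exact: (measurable_sum_sq_dev measurable_tnth2).
  exact: (measurable_sum_sq_dev measurable_tnth1).
apply: measurable_funX; apply: measurable_sum => i; apply: measurable_funM => //.
apply: measurable_funB => //.
exact: (measurable_sample_mean measurable_tnth1).
Qed.

Definition constant_vec : set (vec * vec) := [set yz | sum_sq_dev (tnth yz.2) = 0].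

Lemma measurable_constant_vec : measurable constant_vec.
Proof.
apply: measurable_eqr_set.
exact: (measurable_sum_sq_dev measurable_tnth2).
Qed.

Lemma measurable_nonconstant : measurable [set y : vec | sum_sq_dev (tnth y) != 0].
Proof.
rewrite (_ : [set y | _] = ~` [set y : vec | sum_sq_dev (tnth y) = 0]).
  apply: measurableC; apply: measurable_eqr_set.
  exact: (measurable_sum_sq_dev (fun i => measurable_tnth i)).
by apply/seteqP; split => y /= /eqP.
Qed.

Lemma gauss_constant_vec (y : vec) : gauss k.+2 (xsection constant_vec y) = 0%E.
Proof.
rewrite -[RHS](@gauss_center_eq0 R k); congr (gauss _ _); apply/seteqP.
by split => z; rewrite /xsection/= inE /constant_vec/= sum_sq_devE.
Qed.

(** Centred and normalized, y becomes a unit vector orthogonal to the all-ones vector, as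
    [gauss_cap_center] requires. *)
Lemma gauss_corr_cap t (y : vec) : sum_sq_dev (tnth y) != 0 ->
  gauss k.+2 (xsection (corr_cap t) y) = gauss k.+1 (cap k t).
Proof.
move=> y0.
have ygt0 : 0 < sum_sq_dev (tnth y) by rewrite lt_neqAle eq_sym y0 sum_sq_dev_ge0.
pose u : vec := [tuple
  (tnth y i - sample_mean (tnth y)) / Num.sqrt (sum_sq_dev (tnth y)) | i < k.+2].
have u0 : \sum_(i < k.+2) tnth u i = 0.
  under eq_bigr do rewrite tnth_mktuple.
  by rewrite -mulr_suml sum_dev0 mul0r.
have u1 : inner u u = 1.
  rewrite /inner; under eq_bigr do rewrite tnth_mktuple -expr2 expr_div_n sqr_sqrtr ?ltW//.
  by rewrite -mulr_suml divff.
rewrite -(gauss_cap_center t u0 u1); congr (gauss _ _); apply/seteqP.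
have E z : inner u z ^+ 2 =
    (\sum_i tnth z i * (tnth y i - sample_mean (tnth y))) ^+ 2 / sum_sq_dev (tnth y).
  rewrite -[in RHS](sqr_sqrtr (ltW ygt0)) -expr_div_n mulr_suml; congr (_ ^+ 2).
  by apply: eq_bigr => i _; rewrite tnth_mktuple mulrC mulrA.
by split => z; rewrite /xsection/= inE /corr_cap/= E -sum_sq_devE ltr_pdivlMr// mulrA.
Qed.

End gauss_correlation.

(** * Joint law of the standardized columns and the responses *)

Section sample_law.
Context {R : realType} {d : measure_display} {T : measurableType d}.
Variables (P : probability T R) (n p : nat).
Variables (X : 'I_n -> 'I_p -> {RV P >-> R}) (Y : 'I_n -> {RV P >-> R}).
Variables (m s : 'I_p -> R).
Hypothesis rows : mutual_indep P (fun (i : 'I_n) w => ([tuple X i j w | j < p], Y i w)).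
Hypothesis cols : forall i, mutual_indep P (fun j => X i j : T -> R).
Hypothesis s0 : forall j, 0 < s j.
Hypothesis gX : forall i j (A : set R), measurable A ->
  distribution P (X i j) A = normal_prob (m j) (s j) A.
Hypothesis XY : forall i, indep P (fun w => [tuple X i j w | j < p]) (Y i).

Definition standardized i j w := (X i j w - m j) / s j.

Definition std_columns w : p.-tuple (n.-tuple R) :=
  [tuple [tuple standardized i j w | i < n] | j < p].

Definition responses w : n.-tuple R := [tuple Y i w | i < n].

Lemma measurable_standardized i j : measurable_fun setT (standardized i j).
Proof. by apply: measurable_funM => //; exact: measurable_funB. Qed.

Lemma measurable_std_columns : measurable_fun setT std_columns.
Proof.
apply: measurable_mktuple => j; apply: measurable_mktuple => i.
exact: measurable_standardized.
Qed.

Lemma measurable_responses : measurable_fun setT responses.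
Proof. exact: measurable_mktuple. Qed.

HB.instance Definition _ :=
  isMeasurableFun.Build _ _ _ _ responses measurable_responses.

(** Independence acts in three layers: between rows, between the variables and the response within a
    row, and among the variables of a row. *)
Lemma sample_rectangle (A : 'I_p -> 'I_n -> set R) (B : 'I_n -> set R) :
  (forall j i, measurable (A j i)) -> (forall i, measurable (B i)) ->
  P [set w | forall i, (forall j, A j i (standardized i j w)) /\ B i (Y i w)] =
  (\prod_(i < n) (\prod_(j < p) stdnormal (A j i) * P (Y i @^-1` B i)))%E.
Proof.
move=> mA mB.
pose A' i j := (fun x => (x - m j) / s j) @^-1` A j i.
have mA' i j : measurable (A' i j).
  have mg : measurable_fun setT (fun x : R => (x - m j) / s j).
    by apply: measurable_funM => //; exact: measurable_funB.
  by rewrite -[X in measurable X]setTI; exact: mg.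
have mbox i : measurable (box (A' i)) by exact: measurable_box.
transitivity (P [set w | forall i, (box (A' i) `*` B i) ([tuple X i j w | j < p], Y i w)]).
  congr (P _); apply/seteqP; split => w /= h i.
    by have [hA hB] := h i; split => // j; rewrite tnth_mktuple; exact: hA.
  by have [hA hB] := h i; split => // j; have := hA j; rewrite tnth_mktuple.
rewrite (mutual_indepT (A := fun i => box (A' i) `*` B i) rows); last first.
  by move=> i; exact: measurableX.
apply: eq_bigr => i _.
transitivity (P ((fun w => [tuple X i j w | j < p]) @^-1` box (A' i) `&` Y i @^-1` B i)).
  by congr (P _); apply/seteqP; split => w /= [].
rewrite XY//; congr (_ * _)%E.
transitivity (P [set w | forall j, A' i j (X i j w)]).
  congr (P _); apply/seteqP; split => w /= h j.
    by have := h j; rewrite tnth_mktuple.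
  by rewrite tnth_mktuple; exact: h.
rewrite (mutual_indepT (cols i) (mA' i)); apply: eq_bigr => j _.
rewrite -(normal_prob_standardize (m j) (s0 j) (mA j i)).
exact: (gX i j (mA' i j)).
Qed.

Lemma responses_box (B : 'I_n -> set R) : (forall i, measurable (B i)) ->
  distribution P responses (box B) = (\prod_(i < n) P (Y i @^-1` B i))%E.
Proof.
move=> mB.
have := @sample_rectangle (fun _ _ => setT) B (fun _ _ => measurableT) mB.
under eq_bigr => i _.
  under eq_bigr do rewrite probability_setT.
  rewrite big1_eq mul1e; over.
move=> <-; congr (P _); apply/seteqP; split => w /= h i.
  by split => //; have := h i; rewrite tnth_mktuple.
by rewrite tnth_mktuple; have [_] := h i.
Qed.

Let boxes := [set box A | A in [set A : 'I_n -> set R | forall i, measurable (A i)]].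

Let boxesT : boxes setT.
Proof. by exists (fun=> setT) => //; apply/seteqP; split => x. Qed.

Let boxesE : @measurable _ (n.-tuple R) = <<s boxes >>.
Proof.
apply: (@measurable_tupleE _ _ n measurable) => //.
by rewrite sigma_algebra_id//; exact: sigma_algebra_measurable.
Qed.

Let boxesI : setI_closed boxes.
Proof. by apply: setI_closed_box; exact: measurableI. Qed.

(** Independence is given by rows while the maximum runs over columns; exchanging the products over
    rows and columns regroups the sample. The generators on the side of the columns are boxes whose
    sides are boxes. *)
Lemma sample_law (C : set (p.-tuple (n.-tuple R))) (D : set (n.-tuple R)) :
  measurable C -> measurable D ->
  (P (std_columns @^-1` C `&` responses @^-1` D) =
   tuple_prod (fun _ : 'I_p => gauss n) C * distribution P responses D)%E.
Proof.
move: C D; apply: (product_rule_generated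
    (G1 := [set box A | A in [set A : 'I_p -> set (n.-tuple R) | forall j, boxes (A j)]])
    (mu := tuple_prod (fun _ : 'I_p => gauss n)) (nu := distribution P responses)
    measurable_std_columns measurable_responses _ _ _ boxesE boxesI boxesT).
- exact: measurable_tupleE boxesE boxesT.
- exact: setI_closed_box.
- by exists (fun=> setT) => //; apply/seteqP; split => x.
move=> _ _ [A bA <-] [B mB <-].
have /choice[A' hA'] : forall j, exists A' : 'I_n -> set R,
    (forall i, measurable (A' i)) /\ box A' = A j.
  by move=> j; have [A' mA' A'E] := bA j; exists A'.
have mA' j i : measurable (A' j i) by have [] := hA' j.
have -> : tuple_prod (fun _ : 'I_p => gauss n) (box A) =
    (\prod_(j < p) \prod_(i < n) stdnormal (A' j i))%E.
  rewrite tuple_prod_box.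
    apply: eq_bigr => j _; have [mAj <-] := hA' j.
    exact: tuple_prod_box.
  by move=> j; have [mAj <-] := hA' j; exact: measurable_box.
have rB : (distribution P responses : probability _ _) (box B) = _ := responses_box mB.
rewrite rB exchange_big/= -big_split/= -sample_rectangle//.
congr (P _); apply/seteqP; split => w /=.
  move=> [hA hB] i; split => [j|].
    by have := hA j; have [_ <-] := hA' j => /(_ i); rewrite !tnth_mktuple.
  by have := hB i; rewrite tnth_mktuple.
move=> h; split => [j|i].
  have [_ <-] := hA' j => i; rewrite !tnth_mktuple.
  by have [+ _] := h i; exact.
by rewrite tnth_mktuple; have [] := h i.
Qed.

End sample_law.

(** * Maximal sample correlation *)

Lemma cond_prob_le {R : realType} d (T : measurableType d) (P : probability T R)
    (A D : set T) (b : R) : measurable A -> measurable D -> 0 <= b ->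
  (P (A `&` D) <= b%:E * P D)%E -> (cond_prob P A D <= b%:E)%E.
Proof.
move=> mA mD b0 h; rewrite /cond_prob.
have [D0|D0] := eqVneq (P D) 0%E.
  have : (P (A `&` D) <= 0)%E by rewrite (le_trans h)// D0 mule0.
  by rewrite measure_le0 => /eqP ->; rewrite mul0e lee_fin.
have Dfin : P D \is a fin_num by exact: fin_num_measure.
have [r Dr] : exists r, P D = r%:E by exists (fine (P D)); rewrite fineK.
have r0 : 0 < r by rewrite -lte_fin -Dr lt_neqAle eq_sym D0 measure_ge0.
by rewrite Dr inver gt_eqF// lee_pdivrMr// -Dr.
Qed.

Lemma max_corr_deviation {R : realType} (e : R) : 0 < e -> exists2 B : nat -> R,
  B p @[p --> \oo] --> (0 : R) &
  forall d (T : measurableType d) (P : probability T R) (n p : nat)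
    (X : 'I_n -> 'I_p -> {RV P >-> R}) (Y : 'I_n -> {RV P >-> R}) (m s : 'I_p -> R),
  (3 <= n)%N -> (1 < p)%N ->
  mutual_indep P (fun (i : 'I_n) w => ([tuple X i j w | j < p], Y i w)) ->
  (forall i, mutual_indep P (fun j => X i j : T -> R)) ->
  (forall j, 0 < s j) ->
  (forall i j (A : set R), measurable A ->
    distribution P (X i j) A = normal_prob (m j) (s j) A) ->
  (forall i, indep P (fun w => [tuple X i j w | j < p]) (Y i)) ->
  (cond_prob P
    [set w | e < `|max_corr (fun i j => X i j w) (fun i => Y i w) / sabre n p - 1|]%R
    [set w | forall j, corr_defined (fun i => X i j w) (fun i => Y i w)]
   <= (B p)%:E)%E.
Proof.
move=> e0; have [d d01 de] := shrink_deviation e0; have /andP[d0 d1] := d01.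
have [B B0 hB] := cap_deviation d01; exists B => // dT T P [//|[//|k]] p X Y m s.
rewrite !ltnS => k0 p1 rows cols s0 gX XY.
have nE : k.+2%:R - 2 = k%:R :> R by rewrite -addn2 natrD addrK.
have v0 := @sphere_radius_gt0 R k p k0 p1.
set v : R := 1 - _ in v0.
have t1E : Num.sqrt ((1 + d) * v) ^+ 2 = (1 + d) * v.
  by rewrite sqr_sqrtr// mulr_ge0 ?(ltW v0)// addr_ge0// ltW.
have t2E : Num.sqrt ((1 - d) * v) ^+ 2 = (1 - d) * v.
  by rewrite sqr_sqrtr// mulr_ge0 ?(ltW v0)// subr_ge0 ltW.
have [q [g [q0 hq g01 hg qgB]]] := hB k p _ _ k0 (ltnW p1) t1E t2E.
have b0 : 0 <= B p.
  apply: le_trans qgB; have /andP[_ g1] := g01.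
  by rewrite addr_ge0 ?mulr_ge0// exprn_ge0// subr_ge0.
pose V := std_columns X m s; pose W := responses Y.
have mV : measurable_fun setT V := measurable_std_columns X m s.
have mW : measurable_fun setT W := measurable_responses Y.
have VW := sample_law rows cols s0 gX XY.
pose D := [set y : k.+2.-tuple R | sum_sq_dev (tnth y) != 0].
have mD : measurable D := @measurable_nonconstant R k.
pose nu := distribution P (responses Y).
pose C := [set w | forall j, corr_defined (fun i => X i j w) (fun i => Y i w)].
have mC : measurable C.
  apply: measurable_forall_ord => j.
  have m1 : measurable [set w | sum_sq_dev (fun i => X i j w) = 0].
    by apply: measurable_eqr_set; exact: measurable_sum_sq_dev.
  have m2 : measurable [set w | sum_sq_dev (fun i => Y i w) = 0].
    by apply: measurable_eqr_set; exact: measurable_sum_sq_dev.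
  rewrite (_ : (fun w => _) =
    ~` [set w | sum_sq_dev (fun i => X i j w) = 0] `&`
    ~` [set w | sum_sq_dev (fun i => Y i w) = 0]).
    by apply: measurableI; exact: measurableC.
  by apply/seteqP; split => w /= -[/eqP h1 /eqP h2]; split.
have stdE j w : tnth (tnth (V w) j) = (fun i => (X i j w - m j) / s j).
  by apply/funext => i; rewrite !tnth_mktuple.
have WE w : tnth (W w) = (fun i => Y i w).
  by apply/funext => i; rewrite tnth_mktuple.
have CV w : C w -> forall j, corr_defined (tnth (tnth (V w) j)) (tnth (W w)).
  move=> Cw j; have [X0 Y0] := Cw j; split; last by rewrite WE.
  by rewrite stdE sum_sq_dev_affine mulf_neq0// invr_eq0 sqrf_eq0 gt_eqF.
have corrE j w : sample_corr (fun i => X i j w) (fun i => Y i w) =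
    sample_corr (tnth (tnth (V w) j)) (tnth (W w)).
  by rewrite stdE WE sample_corr_affine.
(* p > 0 provides a column; without one, C would hold vacuously. *)
have CD w : C w -> D (W w).
  by move=> /CV/(_ (Ordinal (ltnW p1)))[].
(* Beyond D, the event C asks that no column be constant. Constant Gaussian columns are null, so the
   existence bound with q = 0 applies, and an estimate by [nu D] is one by [P C]. *)
have PC : (nu D <= P C)%E.
  have h0 w (j : 'I_p) : D w -> (gauss k.+2 (xsection constant_vec w) <= 0%:E)%E.
    by rewrite gauss_constant_vec.
  have := joint_exists_le mV mW VW (@measurable_constant_vec R k) mD (lexx 0) h0.
  have mE := joint_exists_measurable mV mW (@measurable_constant_vec R k) mD.
  rewrite mulr0 mul0e => PE.
  have -> : nu D = P (W @^-1` D) by [].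
  rewrite -[P C]adde0; apply: le_trans (leeD (lexx _) PE).
  apply: le_trans (measureU2 _ mC mE).
  apply: le_measure; rewrite ?inE//.
  - by rewrite -[X in measurable X]setTI; exact: mW.
  - exact: measurableU.
  move=> w Dw; have [Cw|Cw] := pselect (C w); first by left.
  right; split => //; apply: contrapT => h; apply: Cw => j; split; last by rewrite -WE.
  apply/eqP => X0; apply: h; exists j.
  by rewrite /constant_vec/= stdE sum_sq_dev_affine X0 mul0r.
have h1 w (j : 'I_p) : D w ->
    (gauss k.+2 (xsection (corr_cap (Num.sqrt ((1 + d) * v))) w) <= q%:E)%E.
  by move=> Dw; rewrite gauss_corr_cap.
have h2 w (j : 'I_p) : D w ->
    (g%:E <= gauss k.+2 (xsection (corr_cap (Num.sqrt ((1 - d) * v))) w))%E.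
  by move=> Dw; rewrite gauss_corr_cap.
have := joint_deviation_le mV mW VW
  (measurable_corr_cap _) (measurable_corr_cap _) mD q0 g01 h1 h2.
set E := (E in P E) => PE.
have mE : measurable E.
  apply: measurableU.
    exact: (joint_exists_measurable mV mW (measurable_corr_cap _) mD).
  exact: (joint_forall_measurable mV mW (measurable_corr_cap _) mD).
set A := [set w | e < _].
have mA : measurable A.
  apply: measurable_deviation; apply: measurable_bigmax0 => j.
  by apply: measurableT_comp => //; exact: measurable_sample_corr.
apply: cond_prob_le => //.
apply: (@le_trans _ _ ((B p)%:E * nu D)%E); last by rewrite lee_wpmul2l ?lee_fin.
apply: le_trans (le_trans PE _); last by rewrite lee_wpmul2r ?lee_fin.
apply: le_measure; rewrite ?inE//; first exact: measurableI.
move=> w [Aw Cw].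
pose M := max_corr (fun i j => X i j w) (fun i => Y i w).
have M0 : 0 <= M := bigmax0_ge0 _.
have hw : e < `|M / Num.sqrt v - 1| \/ e < `|M ^+ 2 / v - 1|.
  by left; move: Aw; rewrite /A/= /sabre nE.
have [h|h] := ratio_deviation M0 v0 d0 de d1 hw.
  left; split; first exact: CD.
  have [|j hj] := bigmax0_gt _ h; first exact: sqrtr_ge0.
  by exists j; move: hj; rewrite corrE lt_sample_corr ?sqrtr_ge0//; exact: CV.
right; split; first exact: CD.
move=> j hj; apply: (bigmax0_lt
  (F := fun j => `|sample_corr (fun i => X i j w) (fun i => Y i w)|) h (j := j)).
by rewrite corrE lt_sample_corr ?sqrtr_ge0//; exact: CV.
Qed.

Theorem theorem2 (R : realType) :
  (forall (d : nat -> nat -> measure_display)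
      (T : forall n p : nat, measurableType (d n p))
      (P : forall n p : nat, probability (T n p) R)
      (L : forall n p : nat, 'I_p -> {RV (P n p) >-> n.-tuple R})
      (U : forall n p : nat, {RV (P n p) >-> n.-tuple R}),
    (forall n p : nat, (2 <= n)%N -> (0 < p)%N ->
      [/\ iid (P n p) (fun j : 'I_p => L n p j : T n p -> n.-tuple R),
          forall j : 'I_p, uniform_on_sphere (distribution (P n p) (L n p j)),
          distribution (P n p) (U n p) sphere = 1%E
        & indep (P n p) (fun w => [tuple L n p j w | j < p]) (U n p)]) ->
    let M n p w : R := max_inner (fun j : 'I_p => L n p j w) (U n p w) in
    forall delta : R, 0 < delta ->
      unif_vanish 2 (fun n p =>
        P n p [set w | delta < `|M n p w / saber n p - 1|])
      /\
      unif_vanish 2 (fun n p =>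
        P n p [set w | delta <
          `|M n p w ^+ 2 / (1 - p%:R `^ (- (2 / (n%:R - 1)))) - 1|]))
  /\
  (forall (d : nat -> nat -> measure_display)
      (T : forall n p : nat, measurableType (d n p))
      (P : forall n p : nat, probability (T n p) R)
      (X : forall n p : nat, 'I_n -> 'I_p -> {RV (P n p) >-> R})
      (Y : forall n p : nat, 'I_n -> {RV (P n p) >-> R})
      (m s : forall n p : nat, 'I_p -> R),
    (forall n p : nat, (3 <= n)%N -> (0 < p)%N ->
      [/\ iid (P n p) (fun (i : 'I_n) w =>
            ([tuple X n p i j w | j < p], Y n p i w)),
          forall i : 'I_n, mutual_indep (P n p)
            (fun j : 'I_p => X n p i j : T n p -> R),
          forall (i : 'I_n) (j : 'I_p), 0 < s n p j /\
            (forall A : set R, measurable A ->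
              distribution (P n p) (X n p i j) A =
              normal_prob (m n p j) (s n p j) A)
        & forall i : 'I_n, indep (P n p)
            (fun w => [tuple X n p i j w | j < p]) (Y n p i)]) ->
    let M n p w : R :=
      max_corr (fun (i : 'I_n) (j : 'I_p) => X n p i j w)
               (fun i : 'I_n => Y n p i w) in
    forall delta : R, 0 < delta ->
      unif_vanish 3 (fun n p =>
        cond_prob (P n p)
          [set w | delta < `|M n p w / sabre n p - 1|]
          [set w | forall j : 'I_p,
            corr_defined (fun i : 'I_n => X n p i j w)
                         (fun i : 'I_n => Y n p i w)])).

Proof.
split=> [d T P L U hyp|d T P X Y m s hyp M delta delta0].
  by apply: saber_sharp => n p n2 p0; have [[iL _] uL sU iLU] := hyp n p n2 p0.
have [B B0 hB] := max_corr_deviation delta0.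
apply: (unif_vanish_le B0) => n p n3 p1.
have [[rows _] cols gX XY] := hyp n p n3 (ltnW p1).
apply/andP; split.
  by rewrite /cond_prob mule_ge0// inve_ge0.
apply: (hB _ _ _ _ _ _ _ (m n p) (s n p) n3 p1 rows cols _ _ XY).
  (* Positivity of the deviations is stated for each row; n >= 3 supplies a row. *)
  by move=> j; have [] := gX (Ordinal (leq_trans (ltn0Sn 2) n3)) j.
by move=> i j; have [] := gX i j.
Qed.
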